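(* Let $G$ be a super-minimally $3$-connected graph. Then $G$ has at least $\frac{|V(G)|+3}{2}$ vertices of degree three.
   Context: All graphs are finite and simple. A graph is $k$-connected if it has more than $k$ vertices and no vertex cut of size less than $k$. A graph $G$ is super-minimally $k$-connected if $G$ is $k$-connected but no proper subgraph of $G$ is $k$-connected. *)

(* Defs.v *)
From mathcomp Require Import all_boot.

Set Implicit Arguments.
Unset Strict Implicit.
Unset Printing Implicit Defensive.

(* A finite simple graph as a pair (V, E), where E is a set of 2-element
   subsets of V. The vertices are drawn from an ambient finite type T, of which
   V may be a strict part, so that a graph and all its subgraphs live in the
   same type. The well-formedness field is boolean, hence proof-irrelevant:
   equality of graphs is equality of V and E (graph_eq). *)
Record graph (T : finType) := Graph {
  verts : {set T};
  edges : {set {set T}};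
  edgesP : [forall e in edges, (e \subset verts) && (#|e| == 2)]
}.

Lemma graph_eq (T : finType) (G H : graph T) :
  verts G = verts H -> edges G = edges H -> G = H.
Proof.
case: G H => [V E p] [V' E' p'] /= eqV eqE; subst V' E'.
by rewrite (bool_irrelevance p p').
Qed.

Definition adj (T : finType) (G : graph T) : rel T :=
  [rel x y | [set x; y] \in edges G].

Definition degree (T : finType) (G : graph T) (x : T) : nat :=
  #|[set y in verts G | adj G x y]|.

Definition subgraph (T : finType) (H G : graph T) : Prop :=
  verts H \subset verts G /\ edges H \subset edges G.

Definition proper_subgraph (T : finType) (H G : graph T) : Prop :=
  subgraph H G /\ H <> G.

Lemma del_verts_subproof (T : finType) (G : graph T) (S : {set T}) :
  [forall e in [set e in edges G | [disjoint e & S]],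
     (e \subset verts G :\: S) && (#|e| == 2)].
Proof.
apply/forall_inP => e; rewrite inE => /andP[eG eS].
by have /andP[eV ->] := forall_inP (edgesP G) e eG; rewrite subsetD eV eS.
Qed.

(* G - S *)
Definition del_verts (T : finType) (G : graph T) (S : {set T}) : graph T :=
  Graph (del_verts_subproof G S).

(* The graph with no vertex counts as connected; this is immaterial for
   k_connected, where fewer than k of more than k vertices are deleted. *)
Definition connected (T : finType) (G : graph T) : Prop :=
  forall x y : T, x \in verts G -> y \in verts G -> connect (adj G) x y.

Definition vertex_cut (T : finType) (G : graph T) (S : {set T}) : Prop :=
  S \subset verts G /\ ~ connected (del_verts G S).

Definition k_connected (T : finType) (k : nat) (G : graph T) : Prop :=
  k < #|verts G| /\ ~ (exists S : {set T}, vertex_cut G S /\ #|S| < k).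

Definition super_minimally_k_connected
    (T : finType) (k : nat) (G : graph T) : Prop :=
  k_connected k G /\
  ~ (exists H : graph T, proper_subgraph H G /\ k_connected k H).

(* Main.v *)
Require Import Defs.
From mathcomp Require Import all_boot all_order all_algebra zify.

Set Implicit Arguments.
Unset Strict Implicit.
Unset Printing Implicit Defensive.

(* Call a vertex heavy if its degree in G exceeds 3. The graph G is cut along
   3-separations (of vertices and edges together), and each side is contracted to
   a root of degree three; this yields torsos, that is, 3-connected quotients of
   G. Give a root weight 3, a vertex of degree 3 in G weight 2, and a heavy vertex
   weight -1 or -2, according to whether its degree in the torso is 3 or larger.
   For G itself the total is 2 (n3 - f), where n3 and f count the vertices of
   degree three and the heavy ones, so it is enough that every torso has weight
   at least 6. The weight of G is at least the sum of the weights of the two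
   torsos of a separation, minus 6: the two roots account for 6, and a separating
   vertex counts -2 in G but at most -1 in each torso. So one reduces to torsos
   without a nontrivial 3-separation. There, minimality of G makes the heavy
   vertices independent, and criticality gives each non-root vertex of degree 3 at
   most two heavy neighbours, since a 2-separation of G minus an edge or a vertex
   projects to the torso. Counting the edges between heavy and other vertices
   yields weight at least twice the number of heavy vertices, which leaves only
   the case of at most two heavy vertices. Torsos with four vertices may be too
   light, but only if they have two heavy vertices; these are then adjacent, and
   the projection of a 2-separation of G minus the edge joining them contradicts
   the 3-connectivity of the torso that was split. *)

(** * 3-separations *)

(* [lia] splits on every boolean atom of the context. *)
Ltac clia :=
  intros; repeat match goal with
  | H : is_true (in_mem _ _) |- _ => clear H
  | H : is_true (~~ _) |- _ => clear H
  | H : is_true (subset _ _) |- _ => clear H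
  | H : is_true (disjoint _ _) |- _ => clear H
  end; lia.

Section Separations.
Variable T : finType.
Implicit Types (V A B X Z : {set T}) (e : rel T).

Definition nbr e (x : T) := [set y | e x y].

(* The number of edges between [A] and [B], which are meant to be disjoint. *)
Definition links e A B := \sum_(a in A) #|nbr e a :&: B|.

(** 3-connectivity through closed sets in place of paths: a set [A] closed under adjacency away from
    [Z], holding [a] and missing [b], witnesses that [Z] separates them. [A] may meet [Z] and [Z]
    may leave [V], so cuts can be supplied untrimmed. *)
Record conn3 V e : Prop := Conn3 {
  conn3_sym : symmetric e;
  conn3_irr : irreflexive e;
  conn3_sub : forall x y, e x y -> x \in V;
  conn3_card : 3 < #|V|;
  conn3_cut : forall A Z a b, a \in V -> a \in A -> a \notin Z ->
    b \in V -> b \notin A -> b \notin Z ->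
    (forall x y, e x y -> x \in A -> x \notin Z -> y \notin Z -> y \in A) ->
    2 < #|Z| }.

(* A separation of order at most three whose separator consists of the vertices
   outside [A :|: B] and of the edges between [A] and [B]. *)
Record sep3 V e A B : Prop := Sep3 {
  sep3_subl : A \subset V;
  sep3_subr : B \subset V;
  sep3_disj : [disjoint A & B];
  sep3_cardl : 1 < #|A|;
  sep3_cardr : 1 < #|B|;
  sep3_order : #|V :\: (A :|: B)| + links e A B <= 3 }.

(** Two neighbours on each side force degree at least four on every separating vertex. This keeps
    the separator free of roots, which have degree three, and lets the contraction of a side stay
    3-connected. *)
Record normal_sep3 V e A B : Prop := NormalSep3 {
  nsep3_sep : sep3 V e A B;
  nsep3_l : forall s, s \in V -> s \notin A -> s \notin B -> 1 < #|nbr e s :&: A|;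
  nsep3_r : forall s, s \in V -> s \notin A -> s \notin B -> 1 < #|nbr e s :&: B| }.

Lemma cardsI_nbr e x A : #|nbr e x :&: A| = \sum_(a in A) e x a.
Proof.
rewrite -sum1_card (eq_bigl (fun a => (a \in A) && e x a)) ?big_mkcondr.
  by apply: eq_bigr => a _; case: (e x a).
by move=> a; rewrite !inE andbC.
Qed.

Lemma linksC e A B : symmetric e -> links e A B = links e B A.
Proof.
move=> sym; rewrite /links (eq_bigr _ (fun a _ => cardsI_nbr e a B)) exchange_big.
by apply: eq_bigr => b _; rewrite cardsI_nbr; apply: eq_bigr => a _; rewrite sym.
Qed.

Lemma links_setU1 e A B s : s \notin A ->
  links e (s |: A) B = #|nbr e s :&: B| + links e A B.
Proof. by move=> sA; rewrite /links big_setU1. Qed.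

Lemma sep3C V e A B : symmetric e -> sep3 V e A B -> sep3 V e B A.
Proof.
by move=> sym [? ? ? ? ? ?]; split; rewrite // 1?disjoint_sym // setUC linksC.
Qed.

Lemma normal_sep3C V e A B :
  symmetric e -> normal_sep3 V e A B -> normal_sep3 V e B A.
Proof.
move=> sym [s3 sl sr]; split; first exact: sep3C.
- by move=> s sV sB sA; apply: sr.
- by move=> s sV sB sA; apply: sl.
Qed.

(* A vertex of the separator with at most one neighbour in [A] is moved to [B]:
   the separator loses a vertex and gains at most one edge. *)
Lemma sep3_shift V e A B s : symmetric e -> sep3 V e A B ->
  s \in V -> s \notin A -> s \notin B -> #|nbr e s :&: A| <= 1 ->
  sep3 V e A (s |: B).
Proof.
move=> sym [AV BV dis cA cB ord] sV sA sB le1; split=> //.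
- by rewrite subUset sub1set sV.
- by rewrite -setI_eq0 setIUr setU_eq0 !setI_eq0 dis andbT disjoint_sym disjoints1.
- by rewrite cardsU1 sB; clia.
- rewrite linksC // links_setU1 // (linksC _ _ sym).
  have -> : V :\: (A :|: (s |: B)) = (V :\: (A :|: B)) :\ s.
    by apply/setP => x; rewrite !inE; case: (x == s); rewrite /= ?orbT ?andbF.
  have sS : s \in V :\: (A :|: B) by rewrite !inE negb_or sA sB.
  by move: ord; rewrite (cardsD1 s (_ :\: _)) sS; clia.
Qed.

(** Each shift takes a vertex out of the separator, so shifting ends; it ends at a normal
    separation. *)
Lemma normalize_sep3 V e A B : symmetric e -> sep3 V e A B ->
  exists A' B', normal_sep3 V e A' B'.
Proof.
move=> sym; have [n] := ubnP #|V :\: (A :|: B)|.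
elim: n A B => // n IH A B le_n s3.
case: (pickP [pred s | [&& s \in V, s \notin A, s \notin B
         & (#|nbr e s :&: A| <= 1) || (#|nbr e s :&: B| <= 1)]]) => [s|no].
  case/and4P=> sV sA sB few.
  have sS : s \in V :\: (A :|: B) by rewrite !inE negb_or sA sB.
  move: le_n; rewrite (cardsD1 s) sS => le_n.
  have Hl : V :\: (A :|: (s |: B)) = (V :\: (A :|: B)) :\ s.
    by apply/setP => x; rewrite !inE; case: (x == s); rewrite /= ?orbT ?andbF.
  case/orP: few => few.
    by apply: (IH A (s |: B)); [rewrite Hl; lia | apply: sep3_shift].
  apply: (IH (s |: A) B); first by rewrite setUC setUCA (setUC B) -setUCA Hl; clia.
  by apply: sep3C => //; apply: sep3_shift => //; apply: sep3C.
exists A, B; split=> // s sV sA sB.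
- by have := no s; rewrite /= sV sA sB /=; case: leqP.
- by have := no s; rewrite /= sV sA sB /=; case: leqP => // _; case: leqP.
Qed.

End Separations.

(** * Contracting one side of a separation *)

Section Contraction.
Variable T : finType.
Implicit Types (V A B X Z : {set T}) (e : rel T).

Lemma conn3_subr V e x y : conn3 V e -> e x y -> y \in V.
Proof. by move=> c; rewrite (conn3_sym c); apply: conn3_sub. Qed.

Lemma conn3_symE V e x y : conn3 V e -> e x y = e y x.
Proof. by move=> c; apply: conn3_sym c x y. Qed.

Lemma nbr_sub V e x : conn3 V e -> nbr e x \subset V.
Proof. by move=> c; apply/subsetP => y; rewrite inE; apply: conn3_subr. Qed.

(** With at most two neighbours, [x] would be cut off by them from one of the at least three other
    vertices. *)
Lemma conn3_deg V e x : conn3 V e -> x \in V -> 2 < #|nbr e x|.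
Proof.
move=> c xV; rewrite ltnNge; apply/negP => le2.
have : 0 < #|V :\: (x |: nbr e x)|.
  have := cardsD V (x |: nbr e x); have := conn3_card c.
  have := subset_leq_card (subsetIr V (x |: nbr e x)).
  by rewrite cardsU1; case: (x \notin _) => /=; clia.
case/card_gt0P => b; rewrite !inE negb_or => /andP[/andP[bx xb] bV].
have := @conn3_cut _ _ _ c [set x] (nbr e x) x b xV.
rewrite !inE eqxx (conn3_irr c) /= bx xb => /(_ isT isT bV isT isT).
rewrite ltnNge le2 => H; apply: notF; apply: H => u v euv.
by rewrite !inE => /eqP E; rewrite -E euv.
Qed.

Definition qrel (f : T -> T) e : rel T :=
  [rel u v | (u != v) && [exists a, exists b, [&& f a == u, f b == v & e a b]]].

Lemma qrelP f e u v :
  reflect (u <> v /\ exists a b, [/\ f a = u, f b = v & e a b]) (qrel f e u v).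
Proof.
apply: (iffP andP) => [[/eqP uv /existsP[a /existsP[b /and3P[/eqP fa /eqP fb eab]]]]|].
  by split=> //; exists a, b.
case=> /eqP uv [a [b [fa fb eab]]]; split=> //.
by apply/existsP; exists a; apply/existsP; exists b; rewrite fa fb !eqxx.
Qed.

Lemma qrel_sym f e : symmetric e -> symmetric (qrel f e).
Proof.
move=> sym u v; apply/qrelP/qrelP => -[uv [a [b [fa fb eab]]]];
by split; [exact/nesym | exists b, a; rewrite sym].
Qed.

Lemma qrel_irr f e : irreflexive (qrel f e).
Proof. by move=> u; apply/negP => /qrelP[]. Qed.

Lemma qrel_comp f g e : qrel (g \o f) e =2 qrel g (qrel f e).
Proof.
move=> u v; apply/qrelP/qrelP => -[uv [a [b [fa fb eab]]]]; split=> //.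
  exists (f a), (f b); split=> //; apply/qrelP; split; last by exists a, b.
  by move=> E; apply: uv; rewrite -fa -fb /= E.
by case/qrelP: eab => _ [a' [b' [fa' fb' eab']]]; exists a', b'; rewrite /= fa' fb'.
Qed.

Definition collapse B w (x : T) := if x \in B then w else x.

Definition boundary e B := [set u | (u \notin B) && [exists b in B, e b u]].

Lemma qrel_collapse_out e B w u v : irreflexive e -> w \in B ->
  u \notin B -> v \notin B -> qrel (collapse B w) e u v = e u v.
Proof.
move=> irr wB uB vB; apply/qrelP/idP => [[_ [a [b [fa fb eab]]]]|euv].
  move: fa fb; rewrite /collapse.
  case: ifP => [_ E|_ <-]; first by rewrite -E wB in uB.
  by case: ifP => [_ E|_ <- //]; rewrite -E wB in vB.
split; first by move=> E; rewrite E irr in euv.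
by exists u, v; rewrite /collapse (negbTE uB) (negbTE vB).
Qed.

Lemma nbr_collapse e B w : w \in B ->
  nbr (qrel (collapse B w) e) w = boundary e B.
Proof.
move=> wB; apply/setP => u; rewrite !inE.
apply/qrelP/andP => [[wu [a [b [fa fb eab]]]]|[uB /existsP[b /andP[bB ebu]]]].
  move: fa fb eab; rewrite /collapse.
  case: ifP => aB fa; last by rewrite fa wB in aB.
  case: ifP => bB fb eab; first by case: wu.
  by rewrite -fb bB; split=> //; apply/existsP; exists a; rewrite aB.
split; first by move=> E; rewrite -E wB in uB.
by exists b, u; rewrite /collapse bB (negbTE uB).
Qed.

Lemma imset_collapse V B w : w \in B -> B \subset V ->
  collapse B w @: V = w |: (V :\: B).
Proof.
move=> wB BV; apply/setP => u; rewrite !inE.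
apply/imsetP/orP => [[x xV ->]|[/eqP ->|/andP[uB uV]]].
- by rewrite /collapse; case: ifP => xB; [left | right; rewrite xB].
- by exists w; [apply: (subsetP BV) | rewrite /collapse wB].
- by exists u; rewrite // /collapse (negbTE uB).
Qed.

Section Piece.
Variables (V : {set T}) (e : rel T) (A B : {set T}) (w : T).
Hypotheses (c : conn3 V e) (ns : normal_sep3 V e A B) (wB : w \in B).

Let s3 := nsep3_sep ns.

Lemma sep3_notin_r a : a \in A -> a \notin B.
Proof. by move=> aA; rewrite (disjointFr (sep3_disj s3) aA). Qed.

Lemma card_attached : #|[set a in A | nbr e a :&: B != set0]| =
  \sum_(a in A) (nbr e a :&: B != set0).
Proof.
rewrite -sum1_card (eq_bigl (fun a => (a \in A) && (nbr e a :&: B != set0))).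
  by rewrite big_mkcondr; apply: eq_bigr => a _; case: ifP.
by move=> a; rewrite !inE.
Qed.

Lemma attached_le : #|[set a in A | nbr e a :&: B != set0]| <= links e A B.
Proof.
by rewrite card_attached leq_sum // => a _; case: eqP => //; rewrite card_gt0 => /eqP.
Qed.

Lemma boundary_sub : boundary e B \subset
  (V :\: (A :|: B)) :|: [set a in A | nbr e a :&: B != set0].
Proof.
apply/subsetP => u; rewrite !inE => /andP[uB /existsP[b /andP[bB ebu]]].
rewrite (negbTE uB) orbF (conn3_subr c ebu) andbT.
by case: (u \in A) => //=; apply/set0Pn; exists b; rewrite !inE bB (conn3_sym c) ebu.
Qed.

Lemma card_boundary_le :
  #|boundary e B| <= #|V :\: (A :|: B)| + #|[set a in A | nbr e a :&: B != set0]|.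
Proof.
by apply: leq_trans (subset_leq_card boundary_sub) _; rewrite cardsU leq_subr.
Qed.

(** The order bounds the boundary by three. A boundary of at most two vertices would separate [B]
    from any vertex beyond it. If none lies beyond, at most two vertices are outside [B], so each of
    the two or more vertices of [A] sends two edges into [B], which exceeds the order. *)
Lemma card_boundary : #|boundary e B| = 3.
Proof.
apply/eqP; rewrite eqn_leq; apply/andP; split.
  by have := card_boundary_le; have := attached_le; have := sep3_order s3; clia.
rewrite leqNgt; apply/negP => le2.
have [/subsetP sub|] := boolP (V :\: B \subset boundary e B); last first.
  case/subsetPn => z /setDP[zV zB] zN.
  suff H : 2 < #|boundary e B| by move: le2; rewrite ltnNge H.
  apply: (@conn3_cut _ _ _ c B _ w z) => //.
  - exact: (subsetP (sep3_subr s3)).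
  - by rewrite inE wB.
  move=> x y exy xB _; rewrite inE negb_and negbK => /orP[//|/existsP[]].
  by exists x; rewrite xB.
have VB2 : #|V :\: B| <= 2.
  by apply: leq_trans (ltnSE le2); apply/subset_leq_card/subsetP.
have deg a : a \in A -> 2 <= #|nbr e a :&: B|.
  move=> aA; have aV := subsetP (sep3_subl s3) _ aA.
  have := cardsID B (nbr e a); have := conn3_deg c aV.
  have : nbr e a :\: B \subset (V :\: B) :\ a.
    apply/subsetP => y; rewrite !inE => /andP[-> eay]; rewrite (conn3_subr c eay) !andbT.
    by apply/eqP => E; rewrite E (conn3_irr c) in eay.
  move/subset_leq_card; have := cardsD1 a (V :\: B).
  by rewrite inE aV sep3_notin_r //=; clia.
have : \sum_(a in A) 2 <= links e A B by apply: leq_sum.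
rewrite sum_nat_const; have := sep3_order s3; have := sep3_cardl s3; clia.
Qed.

(** A vertex with two edges into [B] would use two units of the order for a single boundary vertex,
    leaving fewer than three of these. *)
Lemma sep3_links_le1 a : a \in A -> #|nbr e a :&: B| <= 1.
Proof.
move=> aA; rewrite leqNgt; apply/negP => ge2.
have : #|[set a in A | nbr e a :&: B != set0]| < links e A B.
  rewrite card_attached /links (bigD1 a) //= [X in _ < X](bigD1 a) //=.
  apply: leq_trans (leq_add ge2 (leqnn _)); rewrite -addSn leq_add //.
    by case: eqP.
  by apply: leq_sum => x _; case: eqP => //; rewrite card_gt0 => /eqP.
have := card_boundary_le; rewrite card_boundary; have := sep3_order s3; clia.
Qed.

(** Serves for cuts of the contraction through the new vertex. If [X] has no boundary vertex,
    [Z :\: B] alone cuts it off. If it has one, [u], then [u] and [Z :\: B] cut off the rest of [X];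
    if there is no rest, [u] has too few neighbours. *)
Lemma sep_sideF X Z x b : X \subset V :\: B -> [disjoint X & Z] -> #|Z :\: B| <= 1 ->
  x \in X -> b \in V -> b \notin B -> b \notin X -> b \notin Z ->
  #|X :&: boundary e B| <= 1 ->
  (forall u v, e u v -> u \in X -> v \notin B -> v \notin Z -> v \in X) -> False.
Proof.
move=> XV XZ Z1 xX bV bB bX bZ N1 cl.
have XVB u : u \in X -> [/\ u \in V, u \notin B & u \notin Z].
  move=> uX; have := subsetP XV _ uX; rewrite inE => /andP[-> ->].
  by rewrite (disjointFr XZ uX).
have toN u y : u \in X -> y \in B -> e u y -> u \in X :&: boundary e B.
  move=> uX yB euy; have [_ uB _] := XVB u uX.
  by rewrite !inE uX uB; apply/existsP; exists y; rewrite yB (conn3_sym c).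
have [E|[u uXN]] := set_0Vmem (X :&: boundary e B).
  have [xV xB xZ] := XVB x xX.
  suff : 2 < #|Z :\: B| by clia.
  apply: (@conn3_cut _ _ _ c X _ x b); rewrite ?inE ?(negbTE xZ) ?(negbTE bZ) ?andbF //.
  move=> y z eyz yX _; rewrite inE negb_and negbK.
  case/orP=> [zB|zZ]; first by have := toN _ _ yX zB eyz; rewrite E inE.
  have [zB|zB] := boolP (z \in B); first by have := toN _ _ yX zB eyz; rewrite E inE.
  exact: cl eyz _ _ _.
have uX : u \in X by move: uXN; rewrite inE => /andP[].
have Nu y : y \in X :&: boundary e B -> y = u.
  by move=> yXN; apply: (card_le1_eqP N1).
have [uV uB uZ] := XVB u uX.
have [|] := boolP (X \subset [set u]).
  move=> /subsetP Xu.
  have out y : e u y -> y \notin B -> y \in Z :\: B.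
    move=> euy yB; rewrite inE yB /=; apply: contraT => yZ.
    have := Xu _ (cl _ _ euy uX yB yZ); rewrite inE => /eqP E.
    by rewrite E (conn3_irr c) in euy.
  have [uA|uA] := boolP (u \in A).
    have := conn3_deg c uV; have := sep3_links_le1 uA; have := cardsID B (nbr e u).
    have : nbr e u :\: B \subset Z :\: B.
      by apply/subsetP => y; rewrite 2!inE => /andP[yB euy]; apply: out.
    by move/subset_leq_card; clia.
  have := nsep3_l ns uV uA uB.
  have : nbr e u :&: A \subset Z :\: B.
    apply/subsetP => y; rewrite 2!inE => /andP[euy yA]; apply: out => //.
    exact: sep3_notin_r.
  by move/subset_leq_card; clia.
case/subsetPn => x' x'X; rewrite inE => x'u.
have [x'V x'B x'Z] := XVB x' x'X.
suff : 2 < #|u |: (Z :\: B)| by rewrite cardsU1; case: (_ \notin _) => /=; clia.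
apply: (@conn3_cut _ _ _ c (X :\ u) _ x' b); rewrite ?inE ?(negbTE x'u) ?(negbTE bZ) ?(negbTE x'Z) ?andbF ?(negbTE bX) //=.
  by rewrite andbF.
  by rewrite orbF; apply: contraNneq bX => ->.
move=> y z eyz; rewrite !inE => /andP[yu yX] _; rewrite negb_or negb_and negbK.
case/andP=> [zu zZ]; rewrite zu /=.
have zB : z \notin B.
  by apply/negP => zB; case/eqP: yu; apply/Nu/(toN _ z).
by apply: (cl _ _ eyz yX zB); rewrite (negbTE zB) in zZ.
Qed.

(** A cut that misses [w] lifts to the original graph, with all of [B] on the side of [w]. A cut
    through [w] has at most one further vertex outside [B]; of its two sides, one meets the
    three-element boundary at most once, and [sep_sideF] applies to it. *)
Lemma collapse_conn3 : conn3 (collapse B w @: V) (qrel (collapse B w) e).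
Proof.
have BV := sep3_subr s3; have wV := subsetP BV _ wB.
have out u v : u \notin B -> v \notin B -> qrel (collapse B w) e u v = e u v.
  exact: qrel_collapse_out (conn3_irr c) wB.
have inw u y : u \notin B -> y \in B -> e u y -> qrel (collapse B w) e w u.
  move=> uB yB euy; apply/qrelP; split; first by move=> E; rewrite -E wB in uB.
  by exists y, u; rewrite /collapse yB (negbTE uB) (conn3_sym c).
have sym := qrel_sym (collapse B w) (conn3_sym c).
split=> //.
- exact: qrel_irr.
- by move=> x y /qrelP[_ [a [b [<- _ eab]]]]; apply/imset_f/(conn3_sub c eab).
- rewrite imset_collapse // cardsU1 !inE wB /= add1n ltnS -card_boundary.
  apply/subset_leq_card/subsetP => u; rewrite !inE => /andP[-> /existsP[y /andP[_]]].
  by move=> eyu; rewrite (conn3_subr c eyu).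
move=> X Z a b; rewrite imset_collapse // !inE => aV aX aZ bV bX bZ cl.
rewrite ltnNge; apply/negP => Z2.
have Z2' : #|Z :\: B| <= 2 by apply: leq_trans (subset_leq_card (subsetDl _ _)) Z2.
have [wZ|wZ] := boolP (w \in Z).
  have aw : a != w by apply: contraNneq aZ => ->.
  have bw : b != w by apply: contraNneq bZ => ->.
  move: aV bV; rewrite (negbTE aw) (negbTE bw) /= => /andP[aB aV] /andP[bB bV].
  have Z1 : #|Z :\: B| <= 1.
    have := cardsID B Z; have : 0 < #|Z :&: B| by apply/card_gt0P; exists w; rewrite inE wZ.
    by clia.
  set X1 := X :&: (V :\: B) :\: Z; set X2 := (V :\: B) :\: X :\: Z.
  have dj (Y : {set T}) : [disjoint Y :\: Z & Z] by rewrite -setI_eq0 setIDAC setDIl setDv setI0.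
  have le3 : #|X1 :&: boundary e B| + #|X2 :&: boundary e B| <= 3.
    rewrite -[in X in _ <= X]card_boundary -cardsUI.
    rewrite [X in _ + #|pred_of_set X|](_ : _ = set0) ?cards0 ?addn0; last first.
      by apply/setP => y; rewrite !inE; case: (y \in X); rewrite ?andbF.
    by apply/subset_leq_card/subsetP => y; rewrite !inE => /orP[/andP[_ ->]|/andP[_ ->]].
  have [N1|N1] := leqP #|X1 :&: boundary e B| 1.
    apply: (@sep_sideF X1 Z a b) => //; rewrite ?inE ?aX ?aZ ?aB ?aV ?(negbTE bX) ?andbF //.
    - by apply/subsetP => y; rewrite !inE => /and3P[_ _].
    - exact: dj.
    move=> u v euv; rewrite !inE => /and4P[uZ uX uB uV] vB vZ.
    rewrite vZ vB (conn3_subr c euv) !andbT.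
    by apply: cl _ uX uZ vZ; rewrite out.
  apply: (@sep_sideF X2 Z b a) => //; rewrite ?inE ?bX ?bZ ?bB ?bV ?aX ?andbF //.
  - by apply/subsetP => y; rewrite !inE => /and3P[_ _].
  - exact: dj.
  - by clia.
  move=> u v euv; rewrite !inE => /and4P[uZ uX uB uV] vB vZ.
  rewrite vZ vB (conn3_subr c euv) !andbT.
  apply: contraNN uX => vX; apply: cl vX vZ uZ; rewrite out // (conn3_sym c); exact: euv.
suff : 2 < #|Z :\: B| by clia.
have [wX|wX] := boolP (w \in X).
  have bw : b != w by apply: contraNneq bX => ->.
  move: bV; rewrite (negbTE bw) /= => /andP[bB bV].
  apply: (@conn3_cut _ _ _ c (X :|: B) _ w b); rewrite ?inE ?wB ?wX ?orbT ?bB ?(negbTE bX) ?(negbTE bZ) //=.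
  move=> x y exy; rewrite !inE !negb_and !negbK.
  have [yB|yB] := boolP (y \in B); first by rewrite orbT.
  rewrite orbF /= => xXB xZ yZ.
  have [xB|xB] := boolP (x \in B).
    by apply: (cl w) => //; apply: (inw y x) => //; rewrite (conn3_sym c).
  move: xXB xZ; rewrite (negbTE xB) orbF /= => xX xZ.
  by apply: cl _ xX xZ yZ; rewrite out.
have aw : a != w by apply: contraNneq wX => <-.
move: aV; rewrite (negbTE aw) /= => /andP[aB aV].
apply: (@conn3_cut _ _ _ c (X :\: B) _ a w); rewrite ?inE ?wB ?aB ?(negbTE aZ) //=.
move=> x y exy; rewrite !inE => /andP[xB xX]; rewrite !negb_and !negbK (negbTE xB) /= => xZ yZ.
have [yB|yB] := boolP (y \in B).
  by case/negP: wX; apply: cl _ xX xZ wZ; rewrite sym; apply: (inw x y).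
by rewrite /=; apply: cl _ xX xZ _; rewrite ?out //; rewrite (negbTE yB) in yZ.
Qed.

(** At most one neighbour of [a] lies in [B], so no two are identified. *)
Lemma nbr_collapse_l a : a \in A ->
  #|nbr (qrel (collapse B w) e) a| = #|nbr e a|.
Proof.
move=> aA; have aB := sep3_notin_r aA.
rewrite -(@card_in_imset _ _ (collapse B w) (nbr e a)).
  apply: eq_card => u; rewrite inE; apply/qrelP/imsetP => [[_ [x [y [fx fy exy]]]]|[y]].
    move: fx; rewrite /collapse; case: ifP => [_ E|_ E]; first by rewrite -E wB in aB.
    by exists y; rewrite ?inE -?E.
  rewrite inE => eay ->; split.
    rewrite /collapse; case: ifP => yB E; first by rewrite E wB in aB.
    by rewrite -E (conn3_irr c) in eay.
  by exists a, y; rewrite {1}/collapse (negbTE aB).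
move=> x y; rewrite !inE /collapse => eax eay.
case: ifP => xB; case: ifP => yB // E.
- by apply: (card_le1_eqP (sep3_links_le1 aA)); rewrite !inE ?eax ?eay.
- by rewrite -E wB in yB.
- by rewrite E wB in xB.
Qed.

Lemma sep3_separator_deg s : s \in V -> s \notin A -> s \notin B -> 3 < #|nbr e s|.
Proof.
move=> sV sA sB; have := nsep3_l ns sV sA sB; have := nsep3_r ns sV sA sB.
have := cardsID B (nbr e s); have : nbr e s :&: A \subset nbr e s :\: B.
  apply/subsetP => y; rewrite !inE => /andP[-> yA]; rewrite andbT; exact: sep3_notin_r.
by move/subset_leq_card; clia.
Qed.

End Piece.
End Contraction.

(** * Torsos and their weights *)

Section Torso.
Variables (T : finType) (V0 : {set T}) (e0 : rel T).
Hypothesis c0 : conn3 V0 e0.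
Implicit Types (p : T -> T) (R A B X : {set T}).

Lemma conn3_ext (V : {set T}) (e e' : rel T) : e =2 e' -> conn3 V e -> conn3 V e'.
Proof.
move=> E [sym irr sub card cut]; split=> //.
- by move=> x y; rewrite -!E.
- by move=> x; rewrite -E.
- by move=> x y; rewrite -E; apply: sub.
move=> A Z a b aV aA aZ bV bA bZ cl; apply: cut aV aA aZ bV bA bZ _.
by move=> x y; rewrite E; apply: cl.
Qed.

Lemma nbr_ext (e e' : rel T) : e =2 e' -> nbr e =1 nbr e'.
Proof. by move=> E x; apply/setP => y; rewrite !inE E. Qed.

(* The quotient of [(V0, e0)] by [p], where only the fibres of the roots [R] may
   have several elements. Fibres need not be connected; [torso_full] is the
   substitute, since it makes every closed part of a fibre see all neighbours of
   the fibre. *)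
Record torso p R : Prop := Torso {
  torso_in : forall x, x \in V0 -> p x \in V0;
  torso_id : forall x, x \in V0 -> p (p x) = p x;
  torso_inj : forall x, x \in V0 -> p x \notin R -> p x = x;
  torso_roots : R \subset p @: V0;
  torso_conn : conn3 (p @: V0) (qrel p e0);
  torso_deg : forall r, r \in R -> #|nbr (qrel p e0) r| = 3;
  torso_full : forall u v X x, x \in X ->
    (forall y, y \in X -> y \in V0 /\ p y = u) ->
    (forall y z, e0 y z -> y \in X -> p z = u -> z \in X) ->
    qrel p e0 u v -> exists y z, [/\ y \in X, p z = v & e0 y z] }.

Section Vertices.
Variables (p : T -> T) (R : {set T}).
Hypothesis t : torso p R.

Lemma torso_sub v : v \in p @: V0 -> v \in V0.
Proof. by case/imsetP => x xV ->; apply: torso_in t _ xV. Qed.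

Lemma torso_fix v : v \in p @: V0 -> p v = v.
Proof. by case/imsetP => x xV ->; apply: torso_id t _ xV. Qed.

Lemma torso_single v x : v \notin R -> x \in V0 -> p x = v -> x = v.
Proof. by move=> vR xV pxv; rewrite -(torso_inj t xV) pxv. Qed.

Lemma torso_deg_le v : v \notin R -> #|nbr (qrel p e0) v| <= #|nbr e0 v|.
Proof.
move=> vR; apply: leq_trans (leq_imset_card p (nbr e0 v)).
apply/subset_leq_card/subsetP => u; rewrite inE => /qrelP[_ [a [b [pa pb eab]]]].
apply/imsetP; exists b => //.
by rewrite inE -(torso_single vR (conn3_sub c0 eab) pa).
Qed.

End Vertices.

Definition fat v := 3 < #|nbr e0 v|.

(* The weight of the header is [gain - loss]. *)
Definition gain R v := if v \in R then 3 else if fat v then 0 else 2.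

Definition loss p R v :=
  if (v \in R) || ~~ fat v then 0
  else if 3 < #|nbr (qrel p e0) v| then 2 else 1.

(** Weight at least 6, written without subtraction of natural numbers. *)
Definition balanced p R :=
  6 + \sum_(v in p @: V0) loss p R v <= \sum_(v in p @: V0) gain R v.

(** * Splitting a torso along a normal 3-separation *)

Section Split.
Variables (p : T -> T) (R A B : {set T}) (w : T).
Hypotheses (t : torso p R) (ns : normal_sep3 (p @: V0) (qrel p e0) A B).
Hypothesis wB : w \in B.

Let s3 := nsep3_sep ns.
Let c := torso_conn t.
Let q := collapse B w \o p.
Let eqq : qrel q e0 =2 qrel (collapse B w) (qrel p e0) := @qrel_comp _ p _ e0.

Lemma separator_notin_roots s : s \in p @: V0 -> s \notin A -> s \notin B -> s \notin R.
Proof.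
move=> sV sA sB; apply/negP => sR.
by have := sep3_separator_deg ns sV sA sB; rewrite (torso_deg t sR).
Qed.

Lemma separator_fat s : s \in p @: V0 -> s \notin A -> s \notin B -> fat s.
Proof.
move=> sV sA sB; have sR := separator_notin_roots sV sA sB.
exact: leq_trans (sep3_separator_deg ns sV sA sB) (torso_deg_le t sR).
Qed.

(** Preservation of [torso_full]; only the fibre over the new root [w] needs a new argument. *)
Lemma split_full u v X x : x \in X ->
  (forall y, y \in X -> y \in V0 /\ q y = u) ->
  (forall y z, e0 y z -> y \in X -> q z = u -> z \in X) ->
  qrel q e0 u v -> exists y z, [/\ y \in X, q z = v & e0 y z].
Proof.
move=> xX XV cl; rewrite eqq => euv.
have qE y : q y = if p y \in B then w else p y by [].
have [uw|uw] := eqVneq u w; last first.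
  have pX y : y \in X -> y \in V0 /\ p y = u.
    move=> yX; have [yV] := XV y yX; rewrite qE; case: ifP => // _ E.
    by rewrite E eqxx in uw.
  have uB : u \notin B.
    by have [xV] := XV x xX; rewrite qE; case: ifP => [_ E|xB <-]; [rewrite E eqxx in uw | rewrite xB].
  have [v' [euv' fv']] : exists v', qrel p e0 u v' /\ collapse B w v' = v.
    have /qrelP[_ [a [b [fa fb eab]]]] := euv.
    exists b; split=> //; suff <- : a = u by [].
    by move: fa; rewrite /collapse; case: ifP => // _ E; rewrite E eqxx in uw.
  have [y z eyz yX pz|y [z [yX pz eyz]]] := torso_full t xX pX _ euv'.
    by apply: cl eyz yX _; rewrite qE pz (negbTE uB).
  by exists y, z; split=> //; rewrite /q /= pz.
subst u; have XB y : y \in X -> y \in V0 /\ p y \in B.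
  by move=> yX; have [yV] := XV y yX; rewrite qE; case: ifP => // pB E; rewrite E wB in pB.
have qB y : p y \in B -> q y = w by rewrite qE => ->.
(* By [torso_full] for [p], the image [D] of [X] is closed within [B]. If [D] missed one of the
   three boundary vertices, those it sees would separate it from that one. So every neighbour of [w]
   is seen from [D], and then from [X]. *)
pose D := [set d in B | [exists x in X, p x == d]].
have inD y : y \in X -> p y \in D.
  by move=> yX; rewrite inE (XB y yX).2; apply/existsP; exists y; rewrite yX eqxx.
have part d d' : d \in D -> qrel p e0 d d' -> exists y z, [/\ y \in X, p z = d' & e0 y z].
  rewrite inE => /andP[dB /existsP[y /andP[yX /eqP pyd]]] edd'.
  have yI : y \in X :&: [set z in V0 | p z == d] by rewrite !inE yX pyd (XB y yX).1 eqxx.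
  have [z|z z' ezz'|z [z' [zI pz' ezz']]] := torso_full t yI _ _ edd'.
  - by rewrite !inE => /and3P[_ -> /eqP].
  - rewrite !inE => /and3P[zX _ pz] pz'; rewrite pz' eqxx (conn3_subr c0 ezz') !andbT.
    by apply: cl ezz' zX _; apply: qB; rewrite pz'.
  by exists z, z'; split=> //; move: zI; rewrite inE => /andP[].
have clD d d' : d \in D -> qrel p e0 d d' -> d' \in B -> d' \in D.
  move=> dD edd' d'B; have [y [z [yX pz eyz]]] := part d d' dD edd'.
  by rewrite -pz; apply: inD; apply: cl eyz yX _; apply: qB; rewrite pz.
pose N := [set u in boundary (qrel p e0) B | [exists d in D, qrel p e0 d u]].
have NE : N = boundary (qrel p e0) B.
  have N3 : 2 < #|N|.
    rewrite ltnNge; apply/negP => N2.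
    have /subsetPn[b bb bN] : ~~ (boundary (qrel p e0) B \subset N).
      apply/negP => /subset_leq_card; rewrite (card_boundary c ns wB); clia.
    suff : 2 < #|N| by clia.
    have bB : b \notin B by move: bb; rewrite inE => /andP[].
    apply: (@conn3_cut _ _ _ c D N (p x) b) => //.
    - exact: subsetP (sep3_subr s3) _ (XB x xX).2.
    - exact: inD.
    - by rewrite !inE (XB x xX).2.
    - by move: bb; rewrite inE => /andP[_ /existsP[d /andP[_]]]; apply: conn3_subr c.
    - by rewrite inE (negbTE bB).
    move=> d d' edd' dD _ d'N; apply: (clD d d') => //; apply: contraNT d'N => d'B.
    rewrite !inE d'B; apply/andP; split; apply/existsP; exists d; rewrite edd' andbT //.
    by move: dD; rewrite inE => /andP[].
  apply/eqP; rewrite eqEcard (card_boundary c ns wB) N3 andbT.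
  by apply/subsetP => u; rewrite inE => /andP[].
have : v \in N by rewrite NE -(nbr_collapse _ wB) inE.
rewrite !inE => /andP[/andP[vB _] /existsP[d /andP[dD edv]]].
have [y [z [yX pz eyz]]] := part d v dD edv.
by exists y, z; split=> //; rewrite qE pz (negbTE vB).
Qed.

Lemma split_torso : torso q (w |: (R :&: A)).
Proof.
have BV := sep3_subr s3; have wV := subsetP BV _ wB.
have qE y : q y = if p y \in B then w else p y by [].
have qV : q @: V0 = collapse B w @: (p @: V0) by rewrite imset_comp.
have qi x : x \in V0 -> q x \in p @: V0.
  by move=> xV; rewrite qE; case: ifP => // _; apply: imset_f.
split.
- by move=> x xV; apply: (torso_sub t); apply: qi.
- move=> x xV; rewrite [q (q x)]qE (torso_fix t (qi x xV)).
  by case: ifP => //; rewrite qE; case: ifP => // ->.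
- move=> x xV; rewrite !inE negb_or qE; case: ifP => [|pB]; first by rewrite eqxx.
  case/andP=> _; rewrite negb_and => pRA.
  have pV := imset_f p xV; apply: torso_inj t _ xV _.
  case/orP: pRA => // pA; apply: separator_notin_roots => //; exact: negbT.
- rewrite qV imset_collapse //; apply/subsetP => u; rewrite !inE.
  case/orP=> [->//|/andP[uR uA]]; rewrite (sep3_notin_r ns uA).
  by rewrite (subsetP (torso_roots t)) ?orbT.
- rewrite qV; apply: conn3_ext (collapse_conn3 c ns wB) => u v; exact/esym/eqq.
- move=> r; rewrite !inE (nbr_ext eqq) => /orP[/eqP ->|/andP[rR rA]].
    by rewrite nbr_collapse // (card_boundary c ns wB).
  by rewrite (nbr_collapse_l c ns wB rA) (torso_deg t).
- exact: split_full.
Qed.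

Lemma split_verts : q @: V0 = w |: (p @: V0 :\: B).
Proof. by rewrite imset_comp imset_collapse // (sep3_subr s3). Qed.

Lemma split_sum (f : T -> nat) : \sum_(v in q @: V0) f v =
  f w + (\sum_(v in A) f v + \sum_(v in p @: V0 :\: (A :|: B)) f v).
Proof.
rewrite split_verts big_setU1 ?inE ?wB //= (big_setID A) /=; congr (_ + (_ + _)).
  apply: eq_bigl => v; rewrite !inE; case: (boolP (v \in A)) => vA; rewrite ?andbF //.
  by rewrite (sep3_notin_r ns vA) (subsetP (sep3_subl s3)).
by apply: eq_bigl => v; rewrite !inE negb_or andbA.
Qed.

(** The 3 is the new root; separating vertices are fat non-roots and gain nothing. *)
Lemma split_gain : \sum_(v in q @: V0) gain (w |: (R :&: A)) v =
  3 + \sum_(v in A) gain R v.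
Proof.
rewrite split_sum {1}/gain !inE eqxx /=; congr (3 + _).
rewrite [X in _ + X]big1 ?addn0 => [|v].
  apply: eq_bigr => v vA; rewrite /gain !inE vA andbT.
  by case: eqP => // E; have := wB; rewrite -E (negbTE (sep3_notin_r ns vA)).
rewrite !inE negb_or => /andP[/andP[vA vB] vV].
rewrite /gain !inE (negbTE vA) andbF orbF (separator_fat vV vA vB).
by case: eqP => // E; rewrite E wB in vB.
Qed.

(** Degrees in [A] survive the contraction, and separating vertices remain fat non-roots, which cost
    at least 1 each. *)
Lemma split_loss : \sum_(v in A) loss p R v + #|p @: V0 :\: (A :|: B)| <=
  \sum_(v in q @: V0) loss q (w |: (R :&: A)) v.
Proof.
rewrite split_sum; apply: leq_trans (leq_addl _ _); apply: leq_add.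
  apply: leq_sum => v vA; rewrite /loss !inE vA andbT (nbr_ext eqq).
  rewrite (nbr_collapse_l c ns wB vA); case: eqP => // E.
  by have := wB; rewrite -E (negbTE (sep3_notin_r ns vA)).
rewrite -sum1_card; apply: leq_sum => v.
rewrite !inE negb_or => /andP[/andP[vA vB] vV].
rewrite /loss !inE (negbTE vA) andbF orbF (separator_fat vV vA vB).
case: eqP => [E|_]; first by rewrite E wB in vB.
by rewrite /=; case: ifP.
Qed.

End Split.

Lemma sum_sep3 (V : {set T}) (e : rel T) A B (f : T -> nat) : sep3 V e A B ->
  \sum_(v in V) f v =
  \sum_(v in A) f v + \sum_(v in B) f v + \sum_(v in V :\: (A :|: B)) f v.
Proof.
move=> s3; rewrite (big_setID (A :|: B)) /=; congr (_ + _).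
have /setIidPr -> : A :|: B \subset V by rewrite subUset (sep3_subl s3) (sep3_subr s3).
rewrite -bigU ?(sep3_disj s3) //; apply: eq_bigl => v; exact: in_setU.
Qed.

(** The two new roots gain 6, which offsets having the bound 6 twice. A separating vertex costs at
    most 2 here and at least 1 in each piece. *)
Lemma balanced_split p R A B wA wB : torso p R ->
  normal_sep3 (p @: V0) (qrel p e0) A B -> wA \in A -> wB \in B ->
  balanced (collapse B wB \o p) (wB |: (R :&: A)) ->
  balanced (collapse A wA \o p) (wA |: (R :&: B)) ->
  balanced p R.
Proof.
move=> t ns wAA wBB; rewrite /balanced.
have ns' := normal_sep3C (conn3_sym (torso_conn t)) ns.
rewrite (split_gain t ns wBB) (split_gain t ns' wAA).
have := split_loss t ns wBB; have := split_loss t ns' wAA.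
rewrite !(sum_sep3 _ (nsep3_sep ns)) (setUC B A).
have : \sum_(v in p @: V0 :\: (A :|: B)) loss p R v <= 2 * #|p @: V0 :\: (A :|: B)|.
  rewrite mulnC -sum_nat_const; apply: leq_sum => v _; rewrite /loss.
  by case: ifP => // _; case: ifP.
clia.
Qed.

End Torso.

(** * Projecting 2-separations to a torso *)

Section Projection.
Variables (T : finType) (V0 : {set T}) (e0 : rel T).
Hypothesis c0 : conn3 V0 e0.
Variables (p : T -> T) (R : {set T}).
Hypothesis t : torso V0 e0 p R.
Implicit Types (A B X Z : {set T}).

(* [Z] separates [A] from [B] after deletion of the edge [xy] if [y \in B], and
   after deletion of the vertex [y] otherwise. *)
Record critical_cut x y A B Z : Prop := CriticalCut {
  cc_x : x \in A;
  cc_xR : p x \notin R;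
  cc_yV : y \in V0;
  cc_yA : y \notin A;
  cc_yZ : y \notin Z;
  cc_yR : p y \notin R;
  cc_AV : A \subset V0;
  cc_BV : B \subset V0;
  cc_ZV : Z \subset V0;
  cc_AB : [disjoint A & B];
  cc_AZ : [disjoint A & Z];
  cc_BZ : [disjoint B & Z];
  cc_Z : #|Z| <= 2;
  cc_cov : forall u, u \in V0 -> [|| u \in A, u \in B, u \in Z | u == y];
  cc_edge : forall a b, a \in A -> b \in B -> e0 a b -> a = x /\ b = y;
  cc_out : y \notin B -> forall u, e0 y u -> p u \notin R }.

Section Cut.
Variables (x y : T) (A B Z : {set T}).
Hypothesis cc : critical_cut x y A B Z.

Let c := torso_conn t.
Local Notation V := (p @: V0).
Local Notation e := (qrel p e0).

Let xV0 : x \in V0. Proof. exact: subsetP (cc_AV cc) _ (cc_x cc). Qed.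
Let px : p x = x. Proof. exact (torso_inj t xV0 (cc_xR cc)). Qed.
Let py : p y = y. Proof. exact (torso_inj t (cc_yV cc) (cc_yR cc)). Qed.
Let xR : x \notin R. Proof. by rewrite -px (cc_xR cc). Qed.
Let yR : y \notin R. Proof. by rewrite -py (cc_yR cc). Qed.
Let xV : x \in V. Proof. by rewrite -px imset_f. Qed.

(** Away from [Z], the only ways out of [A] are the edge [xy] and edges to the deleted vertex [y];
    neither starts over a root. *)
Lemma cc_step_l a z : a \in A -> p a \in R -> e0 a z -> p z \notin p @: Z -> z \in A.
Proof.
move=> aA paR eaz pzZ.
case/or4P: (cc_cov cc (conn3_subr c0 eaz)) => // [zB|zZ|/eqP zy].
- by have [ax _] := cc_edge cc aA zB eaz; rewrite ax (negbTE (cc_xR cc)) in paR.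
- by rewrite imset_f in pzZ.
subst z; have [yB|yB] := boolP (y \in B).
  by have [ax _] := cc_edge cc aA yB eaz; rewrite ax (negbTE (cc_xR cc)) in paR.
rewrite (conn3_sym c0) in eaz.
by have := cc_out cc yB eaz; rewrite paR.
Qed.

Lemma cc_step_r b z : b \in B -> p b \in R -> e0 b z -> p z \notin p @: Z -> z \in B.
Proof.
move=> bB pbR ebz pzZ; have ezb : e0 z b by rewrite (conn3_sym c0).
case/or4P: (cc_cov cc (conn3_subr c0 ebz)) => // [zA|zZ|/eqP zy].
- by have [_ by_] := cc_edge cc zA bB ezb; rewrite by_ (negbTE (cc_yR cc)) in pbR.
- by rewrite imset_f in pzZ.
subst z; apply: contraT => yB.
by have := cc_out cc yB ezb; rewrite pbR.
Qed.

Lemma image_Z v : v \notin R -> v \notin Z -> v \notin p @: Z.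
Proof.
move=> vR; apply: contra => /imsetP[z zZ vE].
by rewrite vE (torso_inj t (subsetP (cc_ZV cc) _ zZ)) // -vE.
Qed.

Let xZ : x \notin p @: Z.
Proof. by rewrite image_Z // (disjointFr (cc_AZ cc) (cc_x cc)). Qed.
Let yZ : y \notin p @: Z. Proof. by rewrite image_Z // (cc_yZ cc). Qed.

Lemma card_image_Z : #|p @: Z| <= 2.
Proof. exact: leq_trans (leq_imset_card _ _) (cc_Z cc). Qed.

(* By [torso_full], a fibre that meets both sides but not [Z] forces the same on
   its neighbours, so that [p @: Z] would separate such fibres from [x]. *)
Lemma cc_nosplit a b : a \in A -> b \in B -> p a = p b -> p a \in p @: Z.
Proof.
move=> aA bB pab; apply: contraT => paZ.
pose D := [set d in V | [exists a in A, p a == d] && [exists b in B, p b == d]].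
have DR d : d \in D -> d \in R.
  rewrite inE => /and3P[_ /existsP[a' /andP[a'A /eqP pa']] /existsP[b' /andP[b'B /eqP pb']]].
  apply: contraT => dR.
  have := torso_single t dR (subsetP (cc_AV cc) _ a'A) pa'.
  have := torso_single t dR (subsetP (cc_BV cc) _ b'B) pb'.
  by move=> E1 E2; rewrite E2 -E1 (disjointFl (cc_AB cc)) in a'A.
suff : 2 < #|p @: Z| by rewrite ltnNge card_image_Z.
have aV0 := subsetP (cc_AV cc) _ aA.
apply: (@conn3_cut _ _ _ c D _ (p a) x) => //; first exact: imset_f.
- rewrite inE imset_f //=; apply/andP; split; apply/existsP; first by exists a; rewrite aA /=.
  by exists b; rewrite bB pab /=.
- by apply: contraNN xR => /DR.
move=> d d' edd' dD dZ d'Z.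
have dR := DR d dD; rewrite inE (conn3_subr c edd') /=.
move: dD; rewrite inE => /and3P[_ /existsP[a' /andP[a'A /eqP pa']] /existsP[b' /andP[b'B /eqP pb']]].
apply/andP; split; apply/existsP.
  have [|||y1 [z1 [+ pz1 eyz]]] := @torso_full _ _ _ _ _ t d d' [set u in A | p u == d] a' _ _ _ edd'.
  - by rewrite inE a'A pa' eqxx.
  - by move=> u; rewrite inE => /andP[uA /eqP]; split=> //; apply: subsetP (cc_AV cc) _ uA.
  - move=> u z euz; rewrite !inE => /andP[uA /eqP pu] pz; rewrite pz eqxx andbT.
    by apply: cc_step_l uA _ euz _; rewrite ?pu ?pz.
  rewrite inE => /andP[y1A /eqP py1]; exists z1; rewrite pz1 eqxx andbT.
  by apply: cc_step_l y1A _ eyz _; rewrite ?py1 ?pz1.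
have [|||y1 [z1 [+ pz1 eyz]]] := @torso_full _ _ _ _ _ t d d' [set u in B | p u == d] b' _ _ _ edd'.
- by rewrite inE b'B pb' eqxx.
- by move=> u; rewrite inE => /andP[uA /eqP]; split=> //; apply: subsetP (cc_BV cc) _ uA.
- move=> u z euz; rewrite !inE => /andP[uA /eqP pu] pz; rewrite pz eqxx andbT.
  by apply: cc_step_r uA _ euz _; rewrite ?pu ?pz.
rewrite inE => /andP[y1A /eqP py1]; exists z1; rewrite pz1 eqxx andbT.
by apply: cc_step_r y1A _ eyz _; rewrite ?py1 ?pz1.
Qed.

(** A torso vertex belongs to its own fibre, so its membership in [A] decides its side; by
    [cc_nosplit] the whole fibre agrees. *)
Definition proj_l := (V :&: A) :\: p @: Z.
Definition proj_r := (V :&: B) :\: p @: Z.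

Lemma proj_l_x : x \in proj_l. Proof. by rewrite !inE xZ xV (cc_x cc). Qed.

Lemma image_l a : a \in A -> p a \notin p @: Z -> p a \in proj_l.
Proof.
move=> aA paZ; have aV0 := subsetP (cc_AV cc) _ aA.
have pV := imset_f p aV0; rewrite !inE paZ pV /=.
case/or4P: (cc_cov cc (torso_sub t pV)) => // [pB|pZ|/eqP pE].
- by case/negP: paZ; apply: cc_nosplit aA pB _; rewrite (torso_fix t pV).
- by case/negP: paZ; rewrite -(torso_fix t pV) imset_f.
by rewrite (torso_single t yR aV0 pE) (negbTE (cc_yA cc)) in aA.
Qed.

Lemma fibre_l v a : v \in proj_l -> a \in V0 -> p a = v -> a \in A.
Proof.
rewrite !inE => /and3P[vZ vV vA] aV pa.
case/or4P: (cc_cov cc aV) => // [aB|aZ|/eqP ay].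
- by case/negP: vZ; rewrite -(torso_fix t vV); apply: cc_nosplit vA aB _; rewrite (torso_fix t vV).
- by case/negP: vZ; rewrite -pa imset_f.
by move: vA; rewrite -pa ay py (negbTE (cc_yA cc)).
Qed.

Lemma fibre_r v a : v \in proj_r -> a \in V0 -> p a = v -> a \in B.
Proof.
rewrite !inE => /and3P[vZ vV vB] aV pa.
case/or4P: (cc_cov cc aV) => // [aA|aZ|/eqP ay].
- by case/negP: vZ; rewrite -pa; apply: cc_nosplit aA vB _; rewrite (torso_fix t vV).
- by case/negP: vZ; rewrite -pa imset_f.
by rewrite ay -py -ay pa.
Qed.

Lemma proj_edge u v : u \in proj_l -> v \in proj_r -> e u v -> [/\ u = x, v = y & y \in B].
Proof.
move=> ul vr /qrelP[_ [a [b [pa pb eab]]]].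
have aA := fibre_l ul (conn3_sub c0 eab) pa.
have bB := fibre_r vr (conn3_subr c0 eab) pb.
have [ax by_] := cc_edge cc aA bB eab.
by split; [rewrite -pa ax px | rewrite -pb by_ py | rewrite -by_].
Qed.

Lemma proj_cov v : v \in V -> v \notin proj_l -> v \notin proj_r ->
  v \in p @: Z \/ y \notin B /\ v = y.
Proof.
move=> vV; rewrite !inE vV /=; case: (boolP (v \in p @: Z)) => [|vZ] /=; first by left.
case/or4P: (cc_cov cc (torso_sub t vV)) => [->|->|vZ'|/eqP ->] //.
  by case/negP: vZ; rewrite -(torso_fix t vV) imset_f.
by right.
Qed.

(** The image of [Z] accounts for at most two; the deleted edge or the deleted vertex is the
    third. *)
Lemma proj_order : #|V :\: (proj_l :|: proj_r)| + links e proj_l proj_r <= 3.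
Proof.
have linkx u : u \in proj_l -> u != x -> #|nbr e u :&: proj_r| = 0.
  move=> ul ux; apply: eq_card0 => v; rewrite !in_setI inE; apply/negP => /andP[euv vr].
  by have [E _ _] := proj_edge ul vr euv; rewrite E eqxx in ux.
have -> : links e proj_l proj_r = #|nbr e x :&: proj_r|.
  rewrite /links (bigD1 x) ?proj_l_x //= big1 ?addn0 // => u /andP[ul ux].
  exact: linkx.
have Z2 := card_image_Z.
have [yB|yB] := boolP (y \in B).
  have : V :\: (proj_l :|: proj_r) \subset p @: Z.
    apply/subsetP => v; rewrite in_setD in_setU negb_or => /andP[/andP[vl vr] vV].
    by case: (proj_cov vV vl vr) => // -[]; rewrite yB.
  move/subset_leq_card.
  have : nbr e x :&: proj_r \subset [set y].
    apply/subsetP => v; rewrite in_setI in_set1 [v \in nbr _ _]inE => /andP[exv vr].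
    by have [_ -> _] := proj_edge proj_l_x vr exv.
  by move/subset_leq_card; rewrite cards1; clia.
have : V :\: (proj_l :|: proj_r) \subset y |: p @: Z.
  apply/subsetP => v; rewrite in_setD in_setU negb_or => /andP[/andP[vl vr] vV].
  by rewrite in_setU1; case: (proj_cov vV vl vr) => [->|[_ ->]]; rewrite ?orbT ?eqxx.
move/subset_leq_card; rewrite cardsU1 yZ /=.
suff -> : #|nbr e x :&: proj_r| = 0 by clia.
apply: eq_card0 => v; rewrite in_setI inE; apply/negP => /andP[exv vr].
by have [_ _] := proj_edge proj_l_x vr exv; rewrite (negbTE yB).
Qed.

Lemma proj_sep3 : 1 < #|proj_l| -> 1 < #|proj_r| -> sep3 V e proj_l proj_r.
Proof.
move=> l1 r1; split=> //; last exact: proj_order.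
- by apply/subsetP => v; rewrite !inE => /and3P[].
- by apply/subsetP => v; rewrite !inE => /and3P[].
- rewrite -setI_eq0; apply/eqP/setP => v; rewrite !inE.
  by case: (boolP (v \in A)) => vA; rewrite ?andbF // (disjointFr (cc_AB cc) vA) !andbF.
Qed.

(** If [x] is alone on its side, its torso neighbours are [y] and two distinct images of [Z]. Being
    fat, [x] has two neighbours with a common image, a root [r]. Were [r] not adjacent to the other
    image [s], then [x] and the at most one vertex of [Z] over [r] would separate the part in [A] of
    the fibre of [r] from [y]. *)
Lemma proj_small : fat e0 x -> #|proj_l| <= 1 ->
  exists r s, [/\ r \in R, e r s & nbr e x = [set r; s; y]].
Proof.
move=> fx l1.
have lx v : v \in proj_l -> v = x.
  by move=> vl; apply: (card_le1_eqP l1); rewrite ?proj_l_x.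
have sub : nbr e x \subset y |: p @: Z.
  apply/subsetP => v; rewrite inE in_setU1 => exv.
  have vx : v != x by apply: contraTneq exv => ->; rewrite (conn3_irr c).
  have [_ [a [b [pa pb eab]]]] := qrelP _ _ _ _ exv.
  have ax := torso_single t xR (conn3_sub c0 eab) pa; subst a.
  case/or4P: (cc_cov cc (conn3_subr c0 eab)) => [bA|bB|bZ|/eqP bE].
  - apply/orP; right; apply: contraT => vZ.
    by case/eqP: vx; apply: lx; rewrite -pb image_l // pb.
  - by have [_ bE] := cc_edge cc (cc_x cc) bB eab; rewrite -pb bE py eqxx.
  - by rewrite -pb imset_f ?orbT.
  - by rewrite -pb bE py eqxx.
have deg3 := conn3_deg c xV.
have Z2 := card_image_Z; have cZ := cc_Z cc.
have cyZ : #|y |: p @: Z| = #|p @: Z|.+1 by rewrite cardsU1 yZ.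
have nE : nbr e x = y |: p @: Z by apply/eqP; rewrite eqEcard sub; clia.
have pZ2 : #|p @: Z| = 2 by move: deg3; rewrite nE; clia.
have injZ : {in Z &, injective p}.
  apply/imset_injP; rewrite eqn_leq leq_imset_card; clia.
have ninj : ~~ [forall a in nbr e0 x, forall b in nbr e0 x, (p a == p b) ==> (a == b)].
  apply/negP => inj; move: fx; rewrite /fat.
  rewrite -(@card_in_imset _ _ p (nbr e0 x)); last first.
    move=> a b aN bN pab; apply/eqP.
    by move/forall_inP: inj => /(_ a aN)/forall_inP/(_ b bN); rewrite pab eqxx.
  have : p @: nbr e0 x \subset nbr e x.
    apply/subsetP => _ /imsetP[b +  ->]; rewrite !inE => exb; apply/qrelP.
    split; last by exists x, b.
    move=> E; have := torso_single t xR (conn3_subr c0 exb) (esym E).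
    by move=> bx; rewrite bx (conn3_irr c0) in exb.
  move/subset_leq_card; rewrite nE; clia.
have [a [b [exa exb pab /eqP ab]]] : exists a b, [/\ e0 x a, e0 x b, p a = p b & a != b].
  case/forall_inPn: ninj => a; rewrite inE => exa /forall_inPn[b]; rewrite inE => exb.
  by rewrite negb_imply => /andP[/eqP pab ab]; exists a, b.
pose r := p a.
have rR : r \in R.
  apply: contraT => rR; case: ab.
  rewrite (torso_single t rR (conn3_subr c0 exa) erefl).
  by rewrite (torso_single t rR (conn3_subr c0 exb) (esym pab)).
have ry : r != y by apply: contraTneq rR => ->.
(* [p] is injective on [Z], so [a] and [b] cannot both lie in [Z]. *)
have [d [pd exd dZ]] : exists d, [/\ p d = r, e0 x d & d \notin Z].
  have [aZ|aZ] := boolP (a \in Z); last by exists a.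
  have [bZ|bZ] := boolP (b \in Z); last by exists b.
  by case: ab; apply: injZ.
have rx : r <> x by move=> E; rewrite E (negbTE xR) in rR.
have exr : e x r by apply/qrelP; split; [exact: nesym | exists x, d].
have rZ : r \in p @: Z.
  have : r \in nbr e x by rewrite inE.
  by rewrite nE in_setU1 (negbTE ry).
have dA : d \in A.
  case/or4P: (cc_cov cc (conn3_subr c0 exd)) => // [dB|dZ'|/eqP dE].
  - have [_ dE] := cc_edge cc (cc_x cc) dB exd.
    by rewrite -pd dE py eqxx in ry.
  - by rewrite dZ' in dZ.
  - by rewrite -pd dE py eqxx in ry.
have [s sE] : exists s, p @: Z = [set r; s].
  have : #|p @: Z :\ r| = 1 by have := cardsD1 r (p @: Z); rewrite rZ pZ2; clia.
  by move/eqP/cards1P => [s sE]; exists s; rewrite -sE setD1K.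
exists r, s; split=> //; last by rewrite nE sE setUC.
have rs : r <> s.
  by move=> E; move: pZ2; rewrite sE E setUid cards1.
apply: contraT => ners.
have key u v : e0 u v -> p u = r -> p v <> s.
  move=> euv pu pv; case/negP: ners; apply/qrelP; split=> //.
  by exists u, v.
suff : 2 < #|x |: (Z :&: [set z | p z == r])|.
  have : #|Z :&: [set z | p z == r]| <= 1.
    apply/card_le1_eqP => u v; rewrite !inE => /andP[uZ /eqP pu] /andP[vZ /eqP pv].
    by apply: injZ; rewrite ?pu ?pv.
  by rewrite cardsU1; case: (x \notin _) => /=; clia.
have xd : d != x by apply: contraTneq exd => ->; rewrite (conn3_irr c0).
have yx : y != x by apply: contraTneq (cc_x cc) => <-; exact: cc_yA cc.
apply: (@conn3_cut _ _ _ c0 [set u in A | p u == r] _ d y).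
- exact: subsetP (cc_AV cc) _ dA.
- by rewrite inE dA pd eqxx.
- by rewrite !inE negb_or xd (negbTE dZ).
- exact: cc_yV cc.
- by rewrite inE (negbTE (cc_yA cc)).
- by rewrite !inE negb_or yx (negbTE (cc_yZ cc)).
move=> u v euv; rewrite !inE => /andP[uA /eqP pu] _.
rewrite negb_or => /andP[vx vZr].
have vV := conn3_subr c0 euv.
have [pvr|pvr] := eqVneq (p v) r.
  rewrite pvr eqxx andbT in vZr; rewrite andbT.
  case/or4P: (cc_cov cc vV) => // [vB|vZ|/eqP vE].
  - by have [ux _] := cc_edge cc uA vB euv; case: rx; rewrite -pu ux px.
  - by rewrite vZ in vZr.
  - by rewrite -pvr vE py eqxx in ry.
exfalso; have [pvZ|pvZ] := boolP (p v \in p @: Z).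
  by move: pvZ; rewrite sE !inE (negbTE pvr) => /eqP; exact: key euv pu.
have vA : v \in A by apply: cc_step_l uA _ euv pvZ; rewrite pu.
have pvx := lx _ (image_l vA pvZ).
by case/eqP: vx; exact (torso_single t xR vV pvx).
Qed.

End Cut.

(** The pair [x], [r] is separated from the vertices other than [x], [r], [s] by the vertex [s], an
    edge from [x] to [y], and at most one edge at [r], which has degree three and sees [x] and
    [s]. *)
Lemma proj_small_sep3 x y r s : 4 < #|p @: V0| -> x \in p @: V0 -> r \in R ->
  qrel p e0 r s -> nbr (qrel p e0) x = [set r; s; y] ->
  exists A B, sep3 (p @: V0) (qrel p e0) A B.
Proof.
have c := torso_conn t.
move=> V5 xV rR ers nx.
have inN v : (v \in [set r; s; y]) = qrel p e0 x v by rewrite -nx inE.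
have exr : qrel p e0 x r by rewrite -inN !inE eqxx.
have exs : qrel p e0 x s by rewrite -inN !inE eqxx orbT.
have rV := subsetP (torso_roots t) _ rR.
have sV := conn3_subr c exs.
have neq u v : qrel p e0 u v -> u != v by apply: contraTneq => ->; rewrite (conn3_irr c).
have xr := neq _ _ exr; have xs := neq _ _ exs; have rs := neq _ _ ers.
have c3 : #|[set x; r; s]| <= 3.
  by rewrite setUC cardsU1 cards2; case: (_ \notin _) => /=; case: (_ != _).
have cV : #|p @: V0 :\: [set x; r; s]| >= 2.
  by have := cardsID [set x; r; s] (p @: V0); have := subset_leq_card (subsetIr (p @: V0) [set x; r; s]); clia.
exists [set x; r], (p @: V0 :\: [set x; r; s]); split=> //.
- by apply/subsetP => v; rewrite !inE => /orP[] /eqP ->.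
- exact: subsetDl.
- rewrite -setI_eq0; apply/eqP/setP => v; rewrite !inE.
  by case: (v == x); case: (v == r); rewrite ?andbF.
- by rewrite cards2 xr.
have S1 : #|p @: V0 :\: ([set x; r] :|: (p @: V0 :\: [set x; r; s]))| <= 1.
  rewrite -(cards1 s); apply/subset_leq_card/subsetP => v; rewrite !inE.
  by case: (v == x); case: (v == r); case: (v == s); case: (v \in _).
have -> : links (qrel p e0) [set x; r] (p @: V0 :\: [set x; r; s]) =
    #|nbr (qrel p e0) x :&: (p @: V0 :\: [set x; r; s])| +
    #|nbr (qrel p e0) r :&: (p @: V0 :\: [set x; r; s])|.
  by rewrite /links big_setU1 ?inE //= big_set1.
have lx : #|nbr (qrel p e0) x :&: (p @: V0 :\: [set x; r; s])| <= 1.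
  rewrite -(cards1 y) nx; apply/subset_leq_card/subsetP => v; rewrite !inE.
  by case: (v == x); case: (v == r); case: (v == s); case: (v == y).
have lr : #|nbr (qrel p e0) r :&: (p @: V0 :\: [set x; r; s])| <= 1.
  have := cardsID [set x; s] (nbr (qrel p e0) r); rewrite (torso_deg t rR).
  have -> : nbr (qrel p e0) r :&: [set x; s] = [set x; s].
    apply/setIidPr/subsetP => v; rewrite !inE => /orP[] /eqP -> //.
    by rewrite (conn3_sym c).
  have : nbr (qrel p e0) r :&: (p @: V0 :\: [set x; r; s]) \subset
      nbr (qrel p e0) r :\: [set x; s].
    apply/subsetP => v; rewrite !inE.
    by case: (v == x); case: (v == r); case: (v == s); rewrite ?andbF //= ?andbT => /andP[].
  by move/subset_leq_card; rewrite cards2 xs; clia.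
by clia.
Qed.

End Projection.

(** * Torsos without 3-separations *)

Section Critical.
Variables (T : finType) (V0 : {set T}) (e0 : rel T).
Hypothesis c0 : conn3 V0 e0.
Implicit Types (p : T -> T) (R A B X Z : {set T}).

(** This and the next condition are what minimality provides. They concern the trivial torso, given
    by [id] and [set0], and are lifted to other torsos by [critical_cut_lift]. *)
Definition edge_critical := forall x y, e0 x y -> fat e0 x -> fat e0 y ->
  exists A B Z, critical_cut V0 e0 id set0 x y A B Z /\ y \in B.

Definition vertex_critical := forall v, v \in V0 -> ~~ fat e0 v ->
  (forall u, e0 v u -> fat e0 u) ->
  exists A B Z x x', [/\ critical_cut V0 e0 id set0 x v A B Z,
    e0 v x, e0 v x', x' \in B & v \notin B].

Hypotheses (ec : edge_critical) (vc : vertex_critical).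

Section Base.
Variables (p : T -> T) (R : {set T}).
Hypothesis t : torso V0 e0 p R.
Let c := torso_conn t.
Local Notation V := (p @: V0).
Local Notation e := (qrel p e0).

Definition heavy := [set v in p @: V0 | (v \notin R) && fat e0 v].

Lemma torso_edge0 x y : x \notin R -> y \notin R -> e x y -> e0 x y.
Proof.
move=> xR yR /qrelP[_ [a [b [pa pb eab]]]].
by rewrite -(torso_single t xR (conn3_sub c0 eab) pa) -(torso_single t yR (conn3_subr c0 eab) pb).
Qed.

Lemma critical_cut_lift x y A B Z : critical_cut V0 e0 id set0 x y A B Z ->
  x \in V -> x \notin R -> y \in V -> y \notin R ->
  (y \notin B -> forall u, e0 y u -> p u \notin R) ->
  critical_cut V0 e0 p R x y A B Z.
Proof.
move=> [] xA xR0 yV yA yZ yR AV BV ZV AB AZ BZ Z2 cov edge out xV xR yVp yR' out'.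
by split=> //; rewrite (torso_fix t).
Qed.

Lemma critical_cutC x y A B Z : critical_cut V0 e0 p R x y A B Z -> y \in B ->
  critical_cut V0 e0 p R y x B A Z.
Proof.
move=> [] xA xR yV yA yZ yR AV BV ZV AB AZ BZ Z2 cov edge out yB.
split=> //.
- exact: subsetP AV _ xA.
- by rewrite (disjointFr AB xA).
- by rewrite (disjointFr AZ xA).
- by rewrite disjoint_sym.
- move=> u uV; case/or4P: (cov u uV) => [->|->|->|/eqP ->]; rewrite ?orbT ?yB //.
- by move=> b a bB aA; rewrite (conn3_sym c0) => /(edge _ _ aA bB)[].
- by rewrite xA.
Qed.

Lemma edge_cut x y : x \in heavy -> y \in heavy -> e x y ->
  exists A B Z, critical_cut V0 e0 p R x y A B Z /\ y \in B.
Proof.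
rewrite !inE => /and3P[xV xR fx] /and3P[yV yR fy] /(torso_edge0 xR yR) exy.
have [A [B [Z [cc yB]]]] := ec exy fx fy.
by exists A, B, Z; split=> //; apply: critical_cut_lift => //; rewrite yB.
Qed.

(** If both projected sides have two vertices, they form the separation. Otherwise a fat vertex is
    alone on its side, and [proj_small] with [proj_small_sep3] yields another one. *)
Lemma cut_sep3 x y x' y' A B Z : 4 < #|V| ->
  critical_cut V0 e0 p R x y A B Z -> critical_cut V0 e0 p R x' y' B A Z ->
  fat e0 x -> fat e0 x' -> exists A B, sep3 V e A B.
Proof.
move=> V5 cc cc' fx fx'.
have small u v A' B' : critical_cut V0 e0 p R u v A' B' Z -> fat e0 u ->
    #|proj_l V0 p A' Z| <= 1 -> exists A B, sep3 V e A B.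
  move=> ccu fu l1; have [r [s [rR ers nE]]] := proj_small c0 t ccu fu l1.
  apply: (proj_small_sep3 t V5 _ rR ers nE).
  have uV := subsetP (cc_AV ccu) _ (cc_x ccu).
  by rewrite -(torso_inj t uV (cc_xR ccu)) imset_f.
have [l1|l1] := leqP #|proj_l V0 p A Z| 1; first exact: small cc fx l1.
have [r1|r1] := leqP #|proj_r V0 p B Z| 1; first exact: small cc' fx' r1.
by exists (proj_l V0 p A Z), (proj_r V0 p B Z); apply: proj_sep3 cc l1 r1.
Qed.

Lemma sum_loss : \sum_(v in V) loss e0 p R v = \sum_(v in heavy) loss e0 p R v.
Proof.
rewrite [RHS](eq_bigl (fun v => (v \in V) && ((v \notin R) && fat e0 v))).
  rewrite big_mkcondr; apply: eq_bigr => v _; rewrite /loss.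
  by case: (v \in R) => //=; case: (fat e0 v).
by move=> v; rewrite !inE.
Qed.

Lemma heavy_sub : heavy \subset V.
Proof. by apply/subsetP => v; rewrite inE => /andP[]. Qed.

Lemma card_light : #|V| = #|heavy| + #|V :\: heavy|.
Proof. by rewrite -(cardsID heavy V) (setIidPr heavy_sub). Qed.

Lemma sum_gain : \sum_(v in V) gain e0 R v = \sum_(v in V :\: heavy) gain e0 R v.
Proof.
rewrite (big_setID heavy) /= (setIidPr heavy_sub) big1 // => v.
by rewrite inE /gain => /and3P[_ /negbTE -> ->].
Qed.

Lemma gain_light : 2 * #|V :\: heavy| + #|R| <= \sum_(v in V :\: heavy) gain e0 R v.
Proof.
have RV : R \subset V :\: heavy.
  by apply/subsetP => r rR; rewrite !inE (subsetP (torso_roots t)) // rR andbF.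
rewrite mulnC -sum_nat_const -sum1_card (big_setID R) /= (setIidPr RV).
rewrite [X in _ <= X](big_setID R) /= (setIidPr RV) addnAC leq_add //.
  by rewrite -big_split leq_sum // => r rR; rewrite /gain rR.
apply: leq_sum => v; rewrite !inE => /and3P[vR H vV].
by move: H; rewrite vV vR /gain (negbTE vR) /= => /negbTE ->.
Qed.

Lemma loss_le2 v : loss e0 p R v <= 2.
Proof. by rewrite /loss; case: ifP => // _; case: ifP. Qed.

Lemma loss_deg v : v \in V -> loss e0 p R v + 2 <= #|nbr e v|.
Proof.
move=> vV; have := conn3_deg c vV; rewrite /loss; case: ifP => _; first by clia.
by case: ifP; clia.
Qed.

(* Without roots [p] is the identity and the degree cannot drop. *)
Lemma heavy3_root v : v \in heavy -> loss e0 p R v <= 1 -> 0 < #|R|.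
Proof.
rewrite inE => /and3P[vV vR fv]; rewrite /loss (negbTE vR) fv /=.
case: ifP => // d3 _; have vV0 := torso_sub t vV.
rewrite card_gt0; apply/negP => /eqP R0.
have pid x : x \in V0 -> p x = x by move=> xV; apply: (torso_inj t) => //; rewrite R0 inE.
case/negP: (negbT d3); apply: leq_trans fv _; apply/subset_leq_card/subsetP => u.
rewrite !inE => evu; apply/qrelP; split; first by move=> E; rewrite E (conn3_irr c0) in evu.
by exists v, u; rewrite !pid // (conn3_subr c0 evu).
Qed.

(** * Weight count in the absence of 3-separations *)

Section NoSep.
Hypotheses (V5 : 4 < #|V|) (nosep : forall A B, ~ sep3 V e A B).

Lemma heavy_indep x y : x \in heavy -> y \in heavy -> ~~ e x y.
Proof.
move=> xH yH; apply/negP => exy; have [A [B [Z [cc yB]]]] := edge_cut xH yH exy.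
have fx : fat e0 x by move: xH; rewrite inE => /and3P[].
have fy : fat e0 y by move: yH; rewrite inE => /and3P[].
by have [A' [B' /nosep]] := cut_sep3 V5 cc (critical_cutC cc yB) fx fy.
Qed.

(** A root has degree and gain 3. If a non-root [w] had three heavy neighbours, these would be all
    of them, so [vc] would apply to [w], and the resulting cut would project to a 3-separation. *)
Lemma light_links w : w \in V :\: heavy -> #|nbr e w :&: heavy| <= gain e0 R w.
Proof.
rewrite inE => /andP[wH wV]; have [wR|wR] := boolP (w \in R).
  by rewrite /gain wR -(torso_deg t wR) subset_leq_card // subsetIl.
have fw : ~~ fat e0 w by move: wH; rewrite inE wV wR.
rewrite /gain (negbTE wR) (negbTE fw) leqNgt; apply/negP => n3.
have d3 : #|nbr e w| <= 3.
  by apply: leq_trans (torso_deg_le c0 t wR) _; move: fw; rewrite /fat -leqNgt.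
have nH : nbr e w \subset heavy.
  apply/setIidPl/eqP; rewrite eqEcard subsetIl; exact: leq_trans d3 n3.
have nw u : e0 w u -> p u \in heavy.
  move=> ewu; apply: subsetP nH _ _; rewrite inE; apply/qrelP; split.
    move=> E; have uw := torso_single t wR (conn3_subr c0 ewu) (esym E).
    by rewrite uw (conn3_irr c0) in ewu.
  by exists w, u; rewrite (torso_fix t wV).
have nwR u : e0 w u -> p u \notin R by move/nw; rewrite inE => /and3P[].
have pu u : e0 w u -> p u = u.
  by move=> ewu; apply: (torso_inj t) (nwR u ewu); apply: conn3_subr c0 ewu.
have nf u : e0 w u -> fat e0 u.
  by move=> ewu; have := nw u ewu; rewrite inE pu // => /and3P[].
have nV u : e0 w u -> u \in V by move=> ewu; rewrite -(pu u ewu) imset_f // (conn3_subr c0 ewu).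
have [A [B [Z [x [x' [cc ewx ewx' x'B wB]]]]]] := vc (torso_sub t wV) fw nf.
have cc1 : critical_cut V0 e0 p R x w A B Z.
  have xR : x \notin R by rewrite -(pu x ewx) nwR.
  exact (critical_cut_lift cc (nV x ewx) xR wV wR (fun _ => nwR)).
have cc2 : critical_cut V0 e0 p R x' w B A Z.
  case: cc1 => xA xR yV yA yZ yR AV BV ZV AB AZ BZ Z2 cov edge out.
  split=> //; try by [apply: nwR | rewrite disjoint_sym].
  - move=> u uV; case/or4P: (cov u uV) => ->; rewrite ?orbT //.
  - move=> b a bB aA; rewrite (conn3_sym c0) => eab.
    by have [_ E] := edge _ _ aA bB eab; rewrite E (negbTE wB) in bB.
by have [A' [B' /nosep]] := cut_sep3 V5 cc1 cc2 (nf _ ewx) (nf _ ewx').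
Qed.

Lemma heavy_links : \sum_(v in heavy) #|nbr e v| <= \sum_(w in V :\: heavy) gain e0 R w.
Proof.
apply: (@leq_trans (\sum_(w in V :\: heavy) #|nbr e w :&: heavy|)); last first.
  by apply: leq_sum => w; apply: light_links.
have -> : \sum_(w in V :\: heavy) #|nbr e w :&: heavy| = links e heavy (V :\: heavy).
  by rewrite linksC //; apply: conn3_sym c.
apply: leq_sum => v vH; apply/subset_leq_card/subsetP => u uN.
rewrite in_setI uN in_setD; move: uN; rewrite inE => evu.
rewrite (conn3_subr c evu) andbT; apply/negP => uH.
by have := heavy_indep vH uH; rewrite evu.
Qed.

(** Call the other vertices light; they have degree at most three. If each saw both heavy vertices,
    it would have at most one light neighbour. As there are at least three light vertices, the two
    heavy ones would be a cut. *)
Lemma heavy2_nonadj : #|heavy| = 2 ->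
  exists v w, [/\ v \in heavy, w \in V :\: heavy & ~~ e v w].
Proof.
move=> H2; case: (boolP [exists v in heavy, exists w in V :\: heavy, ~~ e v w]).
  by case/exists_inP => v vH /exists_inP[w wH nvw]; exists v, w.
move=> all; exfalso.
have adj v w : v \in heavy -> w \in V :\: heavy -> e v w.
  move=> vH wH; apply: contraNT all => nvw.
  by apply/exists_inP; exists v => //; apply/exists_inP; exists w.
have one w : w \in V :\: heavy -> #|nbr e w :&: (V :\: heavy)| <= 1.
  move=> wH; have wV : w \in V by move: wH; rewrite inE => /andP[].
  have d3 : #|nbr e w| <= 3.
    have [wR|wR] := boolP (w \in R); first by rewrite (torso_deg t wR).
    apply: leq_trans (torso_deg_le c0 t wR) _.
    by move: wH; rewrite !inE wV wR /= andbT /fat -leqNgt.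
  have := cardsID heavy (nbr e w).
  have -> : nbr e w :&: heavy = heavy.
    apply/setIidPr/subsetP => v vH; rewrite in_set (conn3_symE w v c); exact: adj.
  have -> : nbr e w :\: heavy = nbr e w :&: (V :\: heavy).
    apply/setP => u; rewrite !inE; case: (boolP (e w u)) => [ewu|]; rewrite ?andbF ?andbT //.
    by rewrite (conn3_subr c ewu) andbT.
  by rewrite H2; clia.
have : 2 < #|V :\: heavy| by have := card_light; clia.
move=> W3; have [w wH] : exists w, w \in V :\: heavy by apply/card_gt0P; clia.
pose A := w |: (nbr e w :&: (V :\: heavy)).
have A2 : #|A| <= 2 by rewrite cardsU1; have := one w wH; case: (_ \notin _) => /=; clia.
have [b bW bA] : exists2 b, b \in V :\: heavy & b \notin A.
  by apply/subsetPn; apply/negP => /subset_leq_card; clia.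
suff : 2 < #|heavy| by rewrite H2.
have wV : w \in V by move: wH; rewrite inE => /andP[].
apply: (@conn3_cut _ _ _ c A heavy w b) => //.
- exact: setU11.
- by move: wH; rewrite in_setD => /andP[].
- by move: bW; rewrite in_setD => /andP[].
- by move: bW; rewrite in_setD => /andP[].
move=> x y exy; rewrite in_setU1 => /orP[/eqP xw|].
  move=> _ yH; rewrite /A in_setU1 in_setI in_setD yH (conn3_subr c exy) inE -xw exy.
  by rewrite orbT.
rewrite in_setI inE => /andP[ewx xW] _ yH; rewrite in_setU1; apply/orP; left.
apply/eqP; apply: (card_le1_eqP (one x xW)).
  by rewrite in_setI wH in_set (conn3_symE x w c) ewx.
by rewrite in_setI in_setD yH (conn3_subr c exy) inE exy.
Qed.

Lemma balanced_base : balanced V0 e0 p R.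
Proof.
rewrite /balanced sum_loss sum_gain.
have L : \sum_(v in heavy) loss e0 p R v + 2 * #|heavy| <= \sum_(w in V :\: heavy) gain e0 R w.
  apply: leq_trans heavy_links; rewrite mulnC -sum_nat_const -big_split leq_sum // => v vH.
  by apply: loss_deg; apply: subsetP heavy_sub _ vH.
(* By [L] the weight is at least twice the number of heavy vertices, so three of them suffice. *)
have [H3|H2] := leqP 3 #|heavy|; first by clia.
have G := gain_light; have cV := card_light.
have L2 : \sum_(v in heavy) loss e0 p R v <= 2 * #|heavy|.
  by rewrite mulnC -sum_nat_const leq_sum // => v _; apply: loss_le2.
have [H2'|/eqP H2'] := eqVneq #|heavy| 2; last by clia.
have [v [w [vH wW nvw]]] := heavy2_nonadj H2'.
have vV := subsetP heavy_sub _ vH.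
have dW : #|nbr e v| < #|V :\: heavy|.
  apply: proper_card; apply/properP; split; last by exists w; rewrite // in_set.
  apply/subsetP => u; rewrite inE => evu; rewrite in_setD (conn3_subr c evu) andbT.
  by apply/negP => uH; have := heavy_indep vH uH; rewrite evu.
have dv := loss_deg vV.
(* If [v] costs 2, its degree is at least four, so five light vertices gain at least 10 against a
   loss of at most 4. Otherwise there is a root, and four light vertices gain at least 9 against a
   loss of at most 3. *)
have [l2|l1] := ltnP 1 (loss e0 p R v); first by clia.
have R1 := heavy3_root vH l1.
have : \sum_(u in heavy) loss e0 p R u <= 3.
  rewrite (bigD1 v) //= (leq_add l1) //.
  have -> : \sum_(u in heavy | u != v) loss e0 p R u = \sum_(u in heavy :\ v) loss e0 p R u.
    by apply: eq_bigl => u; rewrite !inE andbC.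
  apply: leq_trans (_ : \sum_(u in heavy :\ v) 2 <= _).
    by apply: leq_sum => u _; apply: loss_le2.
  by rewrite sum_nat_const; have := cardsD1 v heavy; rewrite vH H2'; clia.
have := conn3_deg c vV.
clia.
Qed.

End NoSep.

(** Degrees are at most three here, so a heavy vertex costs 1 and forces a root; the three other
    vertices then gain at least 7. Without heavy vertices the gain is at least 8. *)
Lemma balanced_small : #|V| <= 4 -> #|heavy| <= 1 -> balanced V0 e0 p R.
Proof.
move=> V4 H1; rewrite /balanced sum_loss sum_gain.
have G := gain_light; have cV := card_light; have := conn3_card c => V3.
have l1 v : v \in heavy -> loss e0 p R v <= 1.
  move=> vH; have vV := subsetP heavy_sub _ vH; rewrite /loss; case: ifP => // _.
  case: ifP => // d4; have : nbr e v \subset V :\ v.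
    apply/subsetP => u; rewrite inE => evu; rewrite in_setD1 (conn3_subr c evu) andbT.
    by apply: contraTneq evu => ->; rewrite (conn3_irr c).
  by move/subset_leq_card; have := cardsD1 v V; rewrite vV; clia.
have lH : \sum_(u in heavy) loss e0 p R u <= #|heavy| by rewrite -sum1_card leq_sum.
have [H0|H0] := posnP #|heavy|; first by clia.
have /card_gt0P[v vH] := H0.
have R1 := heavy3_root vH (l1 v vH).
clia.
Qed.

End Base.
End Critical.

(** * Torsos with four vertices, and the induction *)

Section Induction.
Variables (T : finType) (V0 : {set T}) (e0 : rel T).
Hypothesis c0 : conn3 V0 e0.
Hypotheses (ec : edge_critical V0 e0) (vc : vertex_critical V0 e0).
Implicit Types (p : T -> T) (R A B X Z : {set T}).

Section FourVertices.
Variables (p : T -> T) (R : {set T}).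
Hypothesis t : torso V0 e0 p R.
Let c := torso_conn t.
Local Notation V := (p @: V0).
Local Notation e := (qrel p e0).

(** Otherwise [y] could replace [q] in [p @: Z], giving a cut of at most two vertices between the
    rest of [proj_r] and [x]. *)
Lemma proj_r_le1 x y q A B Z : critical_cut V0 e0 p R x y A B Z -> y \in B ->
  q \in p @: Z -> (forall u, u \in proj_r V0 p B Z -> e q u -> u = y) ->
  #|proj_r V0 p B Z| <= 1.
Proof.
move=> cc yB qZ qy; rewrite leqNgt; apply/negP => r2.
have cc' := critical_cutC c0 cc yB.
have xl := proj_l_x t cc; have yr : y \in proj_r V0 p B Z := proj_l_x t cc'.
have [u] : exists u, u \in proj_r V0 p B Z :\ y.
  by apply/card_gt0P; have := cardsD1 y (proj_r V0 p B Z); rewrite yr; clia.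
rewrite in_setD1 => /andP[uy ur].
have dis v : v \in proj_l V0 p A Z -> v \notin proj_r V0 p B Z.
  by rewrite !inE => /and3P[_ _ vA]; rewrite (disjointFr (cc_AB cc) vA) !andbF.
have inV v : v \in proj_l V0 p A Z -> v \in V by rewrite !inE => /and3P[].
have inV' v : v \in proj_r V0 p B Z -> v \in V by rewrite !inE => /and3P[].
have nZ v : v \in proj_l V0 p A Z -> v \notin p @: Z by rewrite !inE => /and3P[].
have nZ' v : v \in proj_r V0 p B Z -> v \notin p @: Z by rewrite !inE => /and3P[].
suff : 2 < #|y |: (p @: Z :\ q)|.
  have := cardsD1 q (p @: Z); have := card_image_Z cc; rewrite qZ cardsU1.
  by case: (_ \notin _) => /=; clia.
have xy : x != y by apply: contraTneq xl => ->; apply: contraTN yr => /dis.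
apply: (@conn3_cut _ _ _ c (proj_r V0 p B Z :\ y) _ u x).
- exact: inV'.
- by rewrite in_setD1 uy.
- by rewrite in_setU1 in_setD1 negb_or uy (negbTE (nZ' u ur)) andbF.
- exact: inV.
- by rewrite in_setD1 negb_and dis ?orbT.
- by rewrite in_setU1 in_setD1 negb_or xy (negbTE (nZ x xl)) andbF.
move=> a b eab; rewrite in_setD1 => /andP[ay ar] _.
rewrite in_setU1 negb_or in_setD1 negb_and negbK => /andP[by_ bqZ].
rewrite in_setD1 by_ /=; apply: contraT => br.
have [bl|bl] := boolP (b \in proj_l V0 p A Z).
  have [_ E _] : [/\ b = x, a = y & y \in B].
    by apply: (proj_edge c0 t cc bl ar); rewrite (conn3_symE b a c).
  by rewrite E eqxx in ay.
case: (proj_cov t cc (conn3_subr c eab) bl br) => [bZ|[]]; last by rewrite yB.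
move: bqZ; rewrite bZ orbF => /eqP bq.
by move: ay; rewrite (qy a ar) ?eqxx // -bq (conn3_symE b a c).
Qed.

Variables (A B : {set T}).
Hypotheses (ns : normal_sep3 V e A B) (small : #|V :\: B| = 3).
Let s3 := nsep3_sep ns.

(** Two other vertices lie outside [B] and at most one neighbour lies in [B], so minimum degree
    three leaves no choice. *)
Lemma small_nbrs a : a \in A ->
  [/\ #|nbr e a| = 3, #|nbr e a :&: B| = 1 & nbr e a :\: B = (V :\: B) :\ a].
Proof.
move=> aA; have aB := sep3_notin_r ns aA; have aV := subsetP (sep3_subl s3) _ aA.
have sub : nbr e a :\: B \subset (V :\: B) :\ a.
  apply/subsetP => u; rewrite in_setD in_set => /andP[uB eau].
  rewrite in_setD1 in_setD uB (conn3_subr c eau) !andbT.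
  by apply: contraTneq eau => ->; rewrite (conn3_irr c).
have [w wB] : exists w, w \in B by apply/card_gt0P; have := sep3_cardr s3; clia.
have d3 := conn3_deg c aV; have := cardsID B (nbr e a).
have l1 := sep3_links_le1 c ns wB aA.
have := cardsD1 a (V :\: B); rewrite small in_setD aV aB /= => c2.
have := subset_leq_card sub => le2 ID.
have -> : nbr e a :\: B = (V :\: B) :\ a by apply/eqP; rewrite eqEcard sub; clia.
by split=> //; clia.
Qed.

(** Since [z] is the only neighbour of [u] and of [v] in [B], the set of [z] and [k] would separate
    them from the rest of [B]. *)
Lemma small_common u v k z : u \in A -> v \in A -> k \in V -> k \notin B ->
  u != v -> u != k -> v != k -> z \in B -> e u z -> e v z -> False.
Proof.
move=> uA vA kV kB uv uk vk zB euz evz.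
have uB := sep3_notin_r ns uA; have vB := sep3_notin_r ns vA.
have uV := subsetP (sep3_subl s3) _ uA; have vV := subsetP (sep3_subl s3) _ vA.
have VB : V :\: B = [set u; v; k].
  apply/esym/eqP; rewrite eqEcard small; apply/andP; split.
    by apply/subsetP => x; rewrite !inE => /orP[/orP[]|] /eqP ->; rewrite ?uB ?vB ?kB ?uV ?vV ?kV.
  by rewrite setUC cardsU1 cards2 !inE negb_or uv !(eq_sym k) uk vk.
have [b] : exists b, b \in B :\ z.
  by apply/card_gt0P; have := cardsD1 z B; have := sep3_cardr s3; rewrite zB; clia.
rewrite in_setD1 => /andP[bz bB].
have one x : x \in A -> e x z -> forall y, e x y -> y \in B -> y = z.
  move=> xA exz y exy yB; have [_ /eqP n1 _] := small_nbrs xA.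
  by apply: (card_le1_eqP (eq_leq (eqP n1))); rewrite in_setI in_set ?exz ?exy.
suff : 2 < #|[set z; k]| by rewrite cards2; case: (_ != _).
have zu x : x \in B -> forall y, y \notin B -> x != y.
  by move=> xB y; apply: contraNneq => <-.
apply: (@conn3_cut _ _ _ c [set u; v] _ u b); rewrite ?inE ?eqxx //.
- by rewrite negb_or eq_sym (zu z zB u uB) uk.
- exact: subsetP (sep3_subr s3) _ bB.
- by rewrite negb_or !(zu b bB).
- by rewrite negb_or bz (zu b bB).
move=> x y exy xuv _; rewrite !inE negb_or => /andP[yz yk].
have [xA exz] : x \in A /\ e x z by move: xuv; rewrite !inE => /orP[] /eqP ->.
have [yB|yB] := boolP (y \in B); first by rewrite (one x xA exz y exy yB) eqxx in yz.
have : y \in V :\: B by rewrite in_setD yB (conn3_subr c exy).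
by rewrite VB !inE (negbTE yk) orbF.
Qed.

(* Both conclusions of [proj_small] would give [q] and [u] a common neighbour in [B]. *)
Lemma small_triangleF x y q : x \in A -> q \in A -> y \in heavy V0 e0 p R -> x \in heavy V0 e0 p R ->
  y \notin B -> x != q -> x != y -> q != y -> False.
Proof.
move=> xA qA yH xH yB xq xy qy.
have yV : y \in V by move: yH; rewrite inE => /and3P[].
have yR : y \notin R by move: yH; rewrite inE => /and3P[].
have xR : x \notin R by move: xH; rewrite inE => /and3P[].
have fx : fat e0 x by move: xH; rewrite inE => /and3P[].
have fy : fat e0 y by move: yH; rewrite inE => /and3P[].
have xB := sep3_notin_r ns xA; have qB := sep3_notin_r ns qA.
have xV := subsetP (sep3_subl s3) _ xA; have qV := subsetP (sep3_subl s3) _ qA.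
have adj a v : a \in A -> v \in V -> v \notin B -> v != a -> e a v.
  move=> aA vV vB va; have [_ _ E] := small_nbrs aA.
  have : v \in (V :\: B) :\ a by rewrite in_setD1 in_setD va vB.
  by rewrite -E in_setD in_set => /andP[].
have exy : e x y by apply: adj; rewrite // eq_sym.
have eqx : e q x by apply: adj.
have eqy : e q y by apply: adj; rewrite // eq_sym.
have VB v : v \in V -> v \notin B -> [|| v == x, v == q | v == y].
  have : [set x; q; y] = V :\: B.
    apply/eqP; rewrite eqEcard small; apply/andP; split.
      by apply/subsetP => u; rewrite !inE => /orP[/orP[]|] /eqP ->; rewrite ?xB ?qB ?yB.
    by rewrite setUC cardsU1 cards2 !inE negb_or xq !(eq_sym y) xy qy.
  by move/setP/(_ v) => + vV vB; rewrite !inE vV vB -orbA.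
(* [q] is [r] or [s], and these are adjacent, so the other one is a common neighbour of [a] and
   [q]. *)
have common a k r s : a \in A -> a != q -> k != a -> k \notin B -> k \in V -> q != k -> k \notin R ->
    r \in R -> e r s -> nbr e a = [set r; s; k] -> False.
  move=> aA aq ka kB kV qk kR rR ers na.
  have inN v : (v \in [set r; s; k]) = e a v by rewrite -na in_set.
  have ear : e a r by rewrite -inN !inE eqxx.
  have eas : e a s by rewrite -inN !inE eqxx orbT.
  have eaq : e a q by apply: adj; rewrite // eq_sym.
  have rk : r != k by apply: contraTneq rR => ->.
  have d3 := conn3_deg c (subsetP (sep3_subl s3) _ aA).
  have sk : s != k.
    apply: contraTneq d3 => E; rewrite na E -setUA setUid cards2; by case: (_ != _).
  have outB v : e a v -> v != k -> v != q -> v \in B.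
    move=> eav vk vq; apply: contraT => vB.
    have va : v != a by apply: contraTneq eav => ->; rewrite (conn3_irr c).
    have vV := conn3_subr c eav.
    have : [set v; a; q; k] \subset V :\: B.
      apply/subsetP => u; rewrite !inE => /orP[/orP[/orP[]|]|] /eqP ->; rewrite ?vB ?vV ?kB ?kV ?qB ?qV //.
      by rewrite (sep3_notin_r ns aA) (subsetP (sep3_subl s3)).
    move/subset_leq_card; rewrite small setUC cardsU1 setUC cardsU1 cards2 !inE.
    by rewrite !negb_or va ka (eq_sym k v) vk (eq_sym k q) qk (eq_sym q v) vq (eq_sym q a) aq.
  have fin z : e a z -> z != k -> e q z -> False.
    move=> eaz zk eqz; have zq : z != q by apply: contraTneq eqz => ->; rewrite (conn3_irr c).
    by apply: (@small_common a q k z) => //; [rewrite eq_sym | exact: outB].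
  have : q \in [set r; s; k] by rewrite inN.
  rewrite !inE (negbTE qk) orbF => /orP[] /eqP E.
    by apply: (fin s) => //; rewrite E.
  by apply: (fin r) => //; rewrite E (conn3_symE s r c).
have [A' [B' [Z [cc yB']]]] := edge_cut c0 ec t xH yH exy.
have cc' := critical_cutC c0 cc yB'.
have [l1|l2] := leqP #|proj_l V0 p A' Z| 1.
  have [r [s [rR ers nx]]] := proj_small c0 t cc fx l1.
  by apply: (common x y r s) => //; rewrite eq_sym.
have [r1|r2] := leqP #|proj_r V0 p B' Z| 1.
  have [r [s [rR ers ny]]] := proj_small c0 t cc' fy r1.
  have yA : y \in A.
    apply: contraT => yA; have := sep3_separator_deg ns yV yA yB.
    rewrite ny setUC cardsU1 cards2; by case: (_ \notin _); case: (_ != _).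
  by apply: (common y x r s) => //; rewrite ?(eq_sym y) // eq_sym.
have xl := proj_l_x t cc; have yr : y \in proj_r V0 p B' Z := proj_l_x t cc'.
(* Only the edge [xy] joins the projected sides, while [q] is adjacent to both its ends. *)
have qZ : q \in p @: Z.
  have ql : q \notin proj_l V0 p A' Z.
    apply/negP => ql; have [E _ _] := proj_edge c0 t cc ql yr eqy.
    by rewrite E eqxx in xq.
  have qr : q \notin proj_r V0 p B' Z.
    apply/negP => qr; have [_ E _] : [/\ x = x, q = y & y \in B'].
      by apply: (proj_edge c0 t cc xl qr); rewrite (conn3_symE x q c).
    by rewrite E eqxx in qy.
  by case: (proj_cov t cc qV ql qr) => // -[]; rewrite yB'.
have [_ /eqP/cards1P[q' q'E] _] := small_nbrs qA.
have nq u : e q u -> [|| u == x, u == y | u == q'].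
  move=> equ; have [uB|uB] := boolP (u \in B).
    by have : u \in nbr e q :&: B; [rewrite in_setI in_set equ | rewrite q'E inE => ->; rewrite !orbT].
  have uq : u != q by apply: contraTneq equ => ->; rewrite (conn3_irr c).
  by move: (VB u (conn3_subr c equ) uB); rewrite (negbTE uq) /= => /orP[] ->; rewrite ?orbT.
have dis v : v \in proj_l V0 p A' Z -> v \notin proj_r V0 p B' Z.
  by rewrite !inE => /and3P[_ _ vA]; rewrite (disjointFr (cc_AB cc) vA) !andbF.
(* On a side without [q'], the only possible neighbour of [q] is [x] or [y], so [proj_r_le1] makes
   that side too small. *)
have [q'r|q'r] := boolP (q' \in proj_r V0 p B' Z).
  have : #|proj_l V0 p A' Z| <= 1; last by rewrite leqNgt l2.
  apply: (proj_r_le1 cc' (cc_x cc) qZ) => u ul equ.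
  case/or3P: (nq u equ) => /eqP uE //; have := dis u ul; rewrite uE ?q'r ?yr //.
have : #|proj_r V0 p B' Z| <= 1; last by rewrite leqNgt r2.
apply: (proj_r_le1 cc yB' qZ) => u ur equ.
case/or3P: (nq u equ) => /eqP uE //; move: ur; rewrite uE ?(negbTE q'r) // (negbTE (dis _ xl)) //.
Qed.

(** Two heavy vertices and a third one [q] would make up [V :\: B]. At least two of the three lie in
    [A], and [small_triangleF] excludes each distribution. *)
Lemma split_heavy_small w : w \in B ->
  #|heavy V0 e0 (collapse B w \o p) (w |: (R :&: A))| <= 1.
Proof.
move=> wB; rewrite leqNgt; apply/negP => /card_gt1P[x [y [xH yH xy]]].
have old v : v \in heavy V0 e0 (collapse B w \o p) (w |: (R :&: A)) ->
    v \in heavy V0 e0 p R /\ v \notin B.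
  rewrite !inE (split_verts ns wB) !inE negb_or => /and3P[vV /andP[vw vRA] fv].
  move: vV; rewrite (negbTE vw) /= => /andP[vB vV]; rewrite vV fv vB andbT; split=> //.
  move: vRA; rewrite negb_and => /orP[//|vA].
  exact (separator_notin_roots t ns vV vA vB).
have [xH' xB] := old x xH; have [yH' yB] := old y yH.
have inV v : v \in heavy V0 e0 p R -> v \in V by rewrite inE => /andP[].
have [q] : exists q, q \in (V :\: B) :\ x :\ y.
  apply/card_gt0P; have := cardsD1 x (V :\: B); have := cardsD1 y ((V :\: B) :\ x).
  by rewrite small !inE xB yB !inV // eq_sym xy /=; clia.
rewrite !inE => /and4P[qy qx qB qV].
have VB : V :\: B = [set x; y; q].
  apply/esym/eqP; rewrite eqEcard small; apply/andP; split.
    by apply/subsetP => v; rewrite !inE => /orP[/orP[]|] /eqP ->; rewrite ?xB ?yB ?qB ?qV ?inV.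
  by rewrite setUC cardsU1 cards2 !inE negb_or qx qy xy.
have two u v k : V :\: B = [set u; v; k] -> u \notin A -> v \notin A -> False.
  move=> E uA vA; have : A \subset [set k].
    apply/subsetP => a aA; have : a \in V :\: B.
      by rewrite in_setD (sep3_notin_r ns aA) (subsetP (sep3_subl s3)).
    rewrite E !inE => /orP[/orP[]|//] /eqP ak; by rewrite -ak aA in uA vA.
  by move/subset_leq_card; rewrite cards1 leqNgt (sep3_cardl s3).
have [qA|qA] := boolP (q \in A).
  have [xA|xA] := boolP (x \in A).
    by apply: (small_triangleF xA qA yH' xH') => //; rewrite eq_sym.
  have [yA|yA] := boolP (y \in A); last exact: two VB xA yA.
  by apply: (small_triangleF yA qA xH' yH') => //; rewrite eq_sym.
have VB2 : V :\: B = [set q; x; y] by rewrite VB setUC setUA.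
have VB3 : V :\: B = [set q; y; x] by rewrite VB2 setUAC.
have xA : x \in A by apply: contraT => xA; case: (two _ _ _ VB2 qA xA).
have yA : y \in A by apply: contraT => yA; case: (two _ _ _ VB3 qA yA).
(* Here [q] is in the separator, hence heavy, and trades roles with [y]. *)
have qH : q \in heavy V0 e0 p R.
  by rewrite inE qV (separator_notin_roots t ns qV qA qB) (separator_fat c0 t ns qV qA qB).
by apply: (small_triangleF xA yA qH xH') => //; rewrite eq_sym.
Qed.

End FourVertices.

Lemma torso_balanced p R : torso V0 e0 p R ->
  (4 < #|p @: V0|) || (#|heavy V0 e0 p R| <= 1) -> balanced V0 e0 p R.
Proof.
have [n] := ubnP #|p @: V0|; elim: n p R => // n IH p R len t big.
have c := torso_conn t.
have [V4|V4] := leqP #|p @: V0| 4.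
  by apply: balanced_small => //; move: big; rewrite ltnNge V4.
(* The torso is assumed unbalanced; a 3-separation would balance it through its two smaller pieces,
   so [balanced_base] applies. *)
apply: contraT => nb; case/negP: (nb); apply: balanced_base => // A0 B0 s0.
have [A [B ns]] := normalize_sep3 (conn3_sym c) s0.
have ns' := normal_sep3C (conn3_sym c) ns.
have piece A' B' w : normal_sep3 (p @: V0) (qrel p e0) A' B' -> w \in B' ->
    balanced V0 e0 (collapse B' w \o p) (w |: (R :&: A')).
  move=> nsp wB; have tq := split_torso c0 t nsp wB.
  have sV := split_verts nsp wB; have s3 := nsep3_sep nsp.
  have cq : #|(collapse B' w \o p) @: V0| = #|p @: V0 :\: B'|.+1.
    by rewrite sV cardsU1 inE wB.
  have cV := cardsID B' (p @: V0); rewrite (setIidPr (sep3_subr s3)) in cV.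
  have B2 := sep3_cardr s3.
  apply: IH => //; first by clia.
  (* A piece with at most four vertices has exactly four, three of them outside [B']. *)
  have V4q := conn3_card (torso_conn tq).
  have [//|le4] := ltnP 4 #|(collapse B' w \o p) @: V0|.
  by rewrite (split_heavy_small t nsp) //; clia.
have [a aA] : exists a, a \in A.
  by apply/card_gt0P; have := sep3_cardl (nsep3_sep ns); clia.
have [b bB] : exists b, b \in B.
  by apply/card_gt0P; have := sep3_cardr (nsep3_sep ns); clia.
by case/negP: nb; apply: (balanced_split c0 t ns aA bB); apply: piece.
Qed.

End Induction.

(** * Super-minimality *)

Section Graphs.
Variable T : finType.
Implicit Types (G H : graph T) (A B S Z : {set T}).

Lemma adjC G x y : adj G x y = adj G y x.
Proof. by rewrite /adj /= setUC. Qed.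

Lemma adj_verts G x y : adj G x y -> x \in verts G.
Proof.
move=> xy; have /andP[/subsetP sub _] := forall_inP (edgesP G) _ xy.
by apply: sub; rewrite !inE eqxx.
Qed.

Lemma adj_irr G : irreflexive (adj G).
Proof.
move=> x; apply/negP => xx; have /andP[_] := forall_inP (edgesP G) _ xx.
by rewrite setUid cards1.
Qed.

Lemma adj_del_verts G S x y :
  adj (del_verts G S) x y = [&& adj G x y, x \notin S & y \notin S].
Proof. by rewrite /adj /= inE -setI_eq0 setIUl setU_eq0 !setI_eq0 !disjoints1. Qed.

Lemma connect_closed (e : rel T) A x y : (forall u v, e u v -> u \in A -> v \in A) ->
  connect e x y -> x \in A -> y \in A.
Proof.
move=> cl /connectP[s]; elim: s x => [|z s IH] x /=; first by move=> _ ->.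
by case/andP=> exz ez yE xA; apply: IH ez yE _; apply: cl exz xA.
Qed.

Lemma k_connected_conn3 G : k_connected 3 G -> conn3 (verts G) (adj G).
Proof.
case=> V3 nocut; split=> //; [exact: adjC | exact: adj_irr | exact: adj_verts |].
move=> A Z a b aV aA aZ bV bA bZ cl; rewrite ltnNge; apply/negP => Z2.
case: nocut; exists (verts G :&: Z); split; last first.
  by apply: leq_ltn_trans (subset_leq_card (subsetIr _ _)) _.
split; first exact: subsetIl.
move=> /(_ a b); rewrite !inE (negbTE aZ) (negbTE bZ) aV bV => /(_ isT isT) ab.
suff : b \in A :\: Z by rewrite inE (negbTE bA) andbF.
apply: connect_closed ab _; last by rewrite inE aZ.
move=> u v; rewrite adj_del_verts !inE => /and3P[uv uZ vZ] /andP[uZ' uA].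
have vV : v \in verts G by apply: (@adj_verts _ _ u); rewrite adjC.
by move: vZ; rewrite vV /= => vZ; rewrite vZ; apply: cl uv uA uZ' vZ.
Qed.

Lemma not_k_connected G : 3 < #|verts G| -> ~ k_connected 3 G ->
  exists A Z a b, [/\ a \in A, b \in (verts G :\: A) :\: Z, A \subset verts G :\: Z,
    (Z \subset verts G) && (#|Z| <= 2) &
    forall x y, adj G x y -> x \in A -> y \notin Z -> y \in A].
Proof.
move=> V3 nk.
case: (boolP [exists S : {set T}, [&& S \subset verts G, #|S| < 3 &
    [exists x in verts G :\: S, exists y in verts G :\: S, ~~ connect (adj (del_verts G S)) x y]]]).
  case/existsP=> S /and3P[SV S3 /exists_inP[x xV /exists_inP[y yV nxy]]].
  exists [set z in verts G :\: S | connect (adj (del_verts G S)) x z], S, x, y.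
  move: xV yV; rewrite !inE => /andP[xS xV] /andP[yS yV].
  rewrite SV -ltnS S3; split=> //; first by rewrite xS xV /= connect0.
  - by rewrite yS yV (negbTE nxy).
  - by apply/subsetP => z; rewrite inE => /andP[].
  move=> u v uv; rewrite !inE => /andP[/andP[uS uV] xu] vS; rewrite vS.
  rewrite (@adj_verts G v u) 1?adjC //=; apply: connect_trans xu (connect1 _).
  by rewrite adj_del_verts uv uS vS.
move=> no; case: nk; split=> // -[S [[SV nc] S3]]; apply: nc => x y xV yV.
apply: contraT => nxy; case/negP: no; apply/existsP; exists S; rewrite SV S3 /=.
by apply/exists_inP; exists x => //; apply/exists_inP; exists y.
Qed.

Lemma del_edge_subproof G (f : {set T}) :
  [forall e in edges G :\ f, (e \subset verts G) && (#|e| == 2)].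
Proof. by apply/forall_inP => e; rewrite inE => /andP[_]; apply: (forall_inP (edgesP G)). Qed.

Definition del_edge G (f : {set T}) : graph T := Graph (del_edge_subproof G f).

Lemma set2_eq (u v x y : T) : u <> v -> [set u; v] = [set x; y] ->
  (u = x /\ v = y) \/ (u = y /\ v = x).
Proof.
move=> uv E; have : u \in [set x; y] by rewrite -E !inE eqxx.
have : v \in [set x; y] by rewrite -E !inE eqxx orbT.
by rewrite !inE => /orP[] /eqP vE /orP[] /eqP uE; subst; auto.
Qed.

(** Deleting [xy] leaves a cut [Z] of at most two vertices. Since [Z] does not cut [G], some edge
    joins the two sides, and it must be [xy]; its orientation decides which side plays [A]. *)
Lemma super_minimal_edge G : super_minimally_k_connected 3 G ->
  edge_critical (verts G) (adj G).
Proof.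
case=> kG nosub x y exy fx fy; have c := k_connected_conn3 kG.
have nk : ~ k_connected 3 (del_edge G [set x; y]).
  move=> kH; apply: nosub; exists (del_edge G [set x; y]); split=> //.
  split; first by split=> //=; apply: subsetDl.
  move/(congr1 (@edges T))/setP/(_ [set x; y]); rewrite !inE eqxx /= => E.
  by move: exy; rewrite /adj /= -E.
have /= [A [Z [a [b [aA bB AV /andP[ZV Z2] cl]]]]] :=
  @not_k_connected (del_edge G [set x; y]) (conn3_card c) nk.
pose B := (verts G :\: A) :\: Z.
have adjE u v : adj G u v -> [set u; v] != [set x; y] -> adj (del_edge G [set x; y]) u v.
  by rewrite /adj /= !inE => -> ->.
have inA u : u \in A -> u \in verts G /\ u \notin Z.
  by move/(subsetP AV); rewrite inE => /andP[].
have inB u : u \in B -> [/\ u \in verts G, u \notin A & u \notin Z].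
  by rewrite !inE => /and3P[].
have cross u v : u \in A -> v \in B -> adj G u v -> [set u; v] = [set x; y].
  move=> uA /inB[vV vA vZ] uv; apply/eqP; apply: contraT => ne.
  by case/negP: vA; apply: cl (adjE _ _ uv ne) uA vZ.
have [u [v [uA vB uv]]] : exists u v, [/\ u \in A, v \in B & adj G u v].
  case: (boolP [exists u in A, exists v in B, adj G u v]).
    by case/exists_inP=> u uA /exists_inP[v vB uv]; exists u, v.
  move=> no; have [bV bA bZ] := inB b bB; have [aV aZ] := inA a aA.
  suff : 2 < #|Z| by rewrite ltnNge Z2.
  apply: (@conn3_cut _ _ _ c A Z a b) => // u v uv uA _ vZ.
  apply: contraNT no => vA; apply/exists_inP; exists u => //.
  by apply/exists_inP; exists v; rewrite // !inE vA vZ (conn3_subr c uv).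
have cc : critical_cut (verts G) (adj G) id set0 u v A B Z.
  have [vV vA vZ] := inB v vB.
  split; rewrite ?inE //.
  - by apply/subsetP => w /inA[].
  - by apply/subsetP => w /inB[].
  - by rewrite -setI_eq0; apply/eqP/setP => w; rewrite !inE; case: (w \in A); rewrite ?andbF.
  - by rewrite -setI_eq0; apply/eqP/setP => w; rewrite !inE; apply/negP => /andP[/inA[_ /negbTE ->]].
  - by rewrite -setI_eq0; apply/eqP/setP => w; rewrite !inE; case: (w \in Z); rewrite ?andbF.
  - by move=> w wV; rewrite !inE wV andbT; case: (w \in A); case: (w \in Z); rewrite ?orbT.
  - move=> s r sA rB sr; have := cross _ _ sA rB sr; rewrite -(cross _ _ uA vB uv) => E.
    case: (set2_eq _ E) => [sr'|//|[E1 E2]]; first by rewrite sr' adj_irr in sr.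
    by have [_ rA _] := inB r rB; rewrite E2 uA in rA.
  - by move=> _ w _; rewrite inE.
have uv' : u <> v by move=> E; rewrite E adj_irr in uv.
case: (set2_eq uv' (cross _ _ uA vB uv)) => [[<- <-]|[<- <-]]; first by exists A, B, Z.
by exists B, A, Z; split=> //; exact (critical_cutC c cc vB).
Qed.

(** Since the cut [Z] of the graph without [v] does not cut [G], the vertex [v] has neighbours on
    both sides. *)
Lemma super_minimal_vertex G : super_minimally_k_connected 3 G ->
  vertex_critical (verts G) (adj G).
Proof.
case=> kG nosub v vV fv fN; have c := k_connected_conn3 kG.
have nk : ~ k_connected 3 (del_verts G [set v]).
  move=> kH; apply: nosub; exists (del_verts G [set v]); split=> //.
  split; first by split=> /=; [apply: subsetDl | apply/subsetP => f; rewrite inE => /andP[]].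
  by move/(congr1 (@verts T))/setP/(_ v); rewrite !inE eqxx vV.
(* A fat neighbour of [v] and its four or more neighbours make five vertices, of which four
   remain. *)
have V3 : 3 < #|verts (del_verts G [set v])|.
  have [u] : exists u, u \in nbr (adj G) v by apply/card_gt0P; have := conn3_deg c vV; clia.
  rewrite inE => vu; have fu := fN u vu.
  have : u |: nbr (adj G) u \subset verts G.
    by rewrite subUset sub1set (conn3_subr c vu) (nbr_sub u c).
  move/subset_leq_card; rewrite cardsU1 inE adj_irr /=.
  have := cardsD1 v (verts G); rewrite vV; move: fu; rewrite /fat; clia.
have [A [Z [a [b [aA bB AV /andP[ZV Z2] cl]]]]] := not_k_connected V3 nk.
pose B := (verts G :\: [set v] :\: A) :\: Z.
have adjE u w : adj G u w -> u != v -> w != v -> adj (del_verts G [set v]) u w.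
  by rewrite adj_del_verts !inE => -> -> ->.
have inA u : u \in A -> [/\ u \in verts G, u != v & u \notin Z].
  by move/(subsetP AV); rewrite !inE => /and3P[].
have inB u : u \in B -> [/\ u \in verts G, u != v, u \notin A & u \notin Z].
  by rewrite !inE => /and4P[].
have vA : v \notin A by apply/negP => /inA[_]; rewrite eqxx.
have vB : v \notin B by apply/negP => /inB[_]; rewrite eqxx.
have vZ : v \notin Z by apply/negP => /(subsetP ZV); rewrite !inE eqxx.
have cross u w : u \in A -> w \in B -> ~~ adj G u w.
  move=> uA /inB[wV wv wA wZ]; apply/negP => uw; case/negP: wA.
  by have [_ uv _] := inA u uA; apply: cl (adjE _ _ uw uv wv) uA wZ.
have [bV bv bA bZ] := inB b bB; have [aV av aZ] := inA a aA.
have [x [xA vx]] : exists x, x \in A /\ adj G v x.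
  case: (boolP [exists x in A, adj G v x]) => [/exists_inP[x xA vx]|no]; first by exists x.
  suff : 2 < #|Z| by rewrite ltnNge Z2.
  apply: (@conn3_cut _ _ _ c A Z a b) => // u w uw uA _ wZ; have [_ uv _] := inA u uA.
  have wv : w != v.
    apply: contraNneq no => wE; apply/exists_inP; exists u => //.
    by rewrite -wE; have := uw; rewrite adjC.
  by apply: cl (adjE _ _ uw uv wv) uA wZ.
have [x' [xB vx']] : exists x, x \in B /\ adj G v x.
  case: (boolP [exists x in B, adj G v x]) => [/exists_inP[x' xB vx']|no]; first by exists x'.
  suff : 2 < #|Z| by rewrite ltnNge Z2.
  apply: (@conn3_cut _ _ _ c B Z b a) => //; first by rewrite !inE aA andbF.
  move=> u w uw uB _ wZ; rewrite !inE wZ (conn3_subr c uw) andbT /=.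
  apply/andP; split; last first.
    apply: contraNneq no => wE; apply/exists_inP; exists u => //.
    by rewrite -wE; have := uw; rewrite adjC.
  by apply/negP => wA; have := cross _ _ wA uB; rewrite adjC uw.
exists A, B, Z, x, x'; split=> //.
split; rewrite ?inE //.
- by apply/subsetP => w /inA[].
- by apply/subsetP => w /inB[].
- by apply/subsetP => w /(subsetP ZV); rewrite inE => /andP[].
- by rewrite -setI_eq0; apply/eqP/setP => w; rewrite !inE; case: (w \in A); rewrite ?andbF.
- by rewrite -setI_eq0; apply/eqP/setP => w; rewrite !inE; apply/negP => /andP[/inA[_ _ /negbTE ->]].
- by rewrite -setI_eq0; apply/eqP/setP => w; rewrite !inE; case: (w \in Z); rewrite ?andbF.
- move=> w wV; rewrite !inE wV andbT.
  by case: (w == v); case: (w \in A); case: (w \in Z); rewrite ?orbT.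
- by move=> r s rA sB rs; have := cross _ _ rA sB; rewrite rs.
- by move=> _ u _; rewrite inE.
Qed.

Lemma identity_torso (V0 : {set T}) (e0 : rel T) : conn3 V0 e0 -> torso V0 e0 id set0.
Proof.
move=> c; have E : qrel id e0 =2 e0.
  move=> u v; apply/qrelP/idP => [[_ [a [b [<- <-]]]] //|euv].
  by split; [move=> uv; rewrite uv (conn3_irr c) in euv | exists u, v].
split=> //.
- by rewrite sub0set.
- by rewrite imset_id; apply: conn3_ext c => u v; rewrite E.
- by move=> r; rewrite inE.
move=> u v X x xX XV _; rewrite E => euv; exists u, v; split=> //.
by have [_ <-] := XV x xX.
Qed.

End Graphs.

(** * From the weight of the graph to its vertices of degree three *)

Theorem theorem1p8 (T : finType) (G : graph T)
    (hG : super_minimally_k_connected 3 G) :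
  ((#|verts G|%:R + 3) / 2 <= #|[set x in verts G | degree G x == 3%N]|%:R :> rat)%R.
Proof.
have c := k_connected_conn3 hG.1; have t := identity_torso c.
have ec := super_minimal_edge hG; have vc := super_minimal_vertex hG.
pose F := [set x in verts G | fat (adj G) x].
have degE x : degree G x = #|nbr (adj G) x|.
  apply: eq_card => y; rewrite !inE andb_idl // => xy; exact: conn3_subr c xy.
have E3 : [set x in verts G | degree G x == 3] = verts G :\: F.
  apply/setP => x; rewrite !inE degE /fat; case: (boolP (x \in verts G)) => xV; rewrite ?andbF //=.
  by have := conn3_deg c xV; rewrite andbT -leqNgt eqn_leq => ->; rewrite andbT.
have heavyE : heavy (verts G) (adj G) id set0 = F.
  by apply/setP => x; rewrite !inE imset_id.
have FV : F \subset verts G by apply/subsetP => x; rewrite inE => /andP[].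
have cV : #|verts G| = #|F| + #|verts G :\: F| by rewrite -(cardsID F) (setIidPr FV).
have nE x : nbr (qrel id (adj G)) x = nbr (adj G) x.
  apply/setP => y; rewrite !in_set; apply/qrelP/idP => [[_ [a [b [<- <-]]]] //|xy].
  by split; [move=> E; rewrite E adj_irr in xy | exists x, y].
(* Four vertices leave no room for a vertex of degree four. *)
have small : (4 < #|id @: verts G|) || (#|heavy (verts G) (adj G) id set0| <= 1).
  rewrite imset_id heavyE; have [//|V4] := ltnP; rewrite (_ : F = set0) ?cards0 //.
  apply/setP => x; rewrite !inE; apply/negP => /andP[xV]; rewrite /fat => d4.
  have : x |: nbr (adj G) x \subset verts G by rewrite subUset sub1set xV (nbr_sub x c).
  by move/subset_leq_card; rewrite cardsU1 inE adj_irr /=; clia.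
have := torso_balanced c ec vc t small; rewrite /balanced (sum_loss _ _ _) (sum_gain _ _) heavyE.
rewrite imset_id.
rewrite (eq_bigr (fun=> 2)) ?sum_nat_const => [|x]; last first.
  by rewrite inE /loss inE nE => /andP[_ fx]; rewrite fx /=; move: fx; rewrite /fat => ->.
rewrite [X in _ <= X](eq_bigr (fun=> 2)) ?sum_nat_const => [|x]; last first.
  rewrite !inE /gain inE => /andP[fx xV]; by move: fx; rewrite xV /= => /negbTE ->.
(* [bal] says that the vertices of degree three outnumber those in [F] by at least 3, which is the
   claim by [cV]. *)
move=> bal; rewrite E3 Num.Theory.ler_pdivrMr // -GRing.natrM -GRing.natrD Num.Theory.ler_nat.
by rewrite cV; clia.
Qed.
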